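(* Let $\kappa$ be a regular uncountable cardinal and $\chi$ a cardinal such that $\mathrm{P}_{14}(\kappa,\sqsubseteq,\kappa,\{E^\kappa_{\ge\chi}\})$ holds and $\lambda^{<\chi}<\kappa$ for all $\lambda<\kappa$. If $\theta$ is an infinite cardinal with $\theta^+<\chi$, then there exists a downward-closed $T\subseteq{}^{<\kappa}\kappa$ which is a prolific slim $(\chi,\theta^+)$-free $\kappa$-Souslin tree admitting an injective $\mathcal F^{\mathrm{fin}}_\theta$-ascent path.
   Context: Downward-closed subsets of ${}^{<\kappa}\kappa$ are ordered by $\subsetneq$, height $=\mathrm{dom}$, $T_\alpha=T\cap{}^\alpha\kappa$. Prolific: $x^\frown\langle i\rangle\in T$ for $x\in T_\alpha$, $i<\max\{\omega,\alpha\}$. Slim: $|T_\alpha|\le\max\{|\alpha|,\aleph_0\}$. $\kappa$-Souslin: height $\kappa$, levels of size $<\kappa$, no cofinal branch, no antichain of size $\kappa$. $T^\tau=\{f:\tau\to T\mid\mathrm{ht}\circ f$ constant$\}$; for nonzero $\tau$, $\beta<\kappa$ and distinct $\langle w_i\mid i<\tau\rangle\in{}^\tau T_\beta$, the derived tree $\bigotimes_{i<\tau}w_i^\uparrow$ is the set of $f\in T^\tau$ with each $f(i)$ compatible with $w_i$. $T$ is $(\chi,\eta)$-free if for every nonzero $\tau<\chi$, $\beta<\kappa$, distinct $\langle w_i\mid i<\tau\rangle\in{}^\tau T_\beta$ and every $A\subseteq\bigotimes_{i<\tau}w_i^\uparrow$ of size $\kappa$, there are $\vec x,\vec y\in A$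 with $|\{i<\tau\mid\neg(\vec x(i)\subsetneq\vec y(i))\}|<\eta$. $\mathcal F^{\mathrm{fin}}_\theta=\{Z\subseteq\theta\mid|\theta\setminus Z|<\aleph_0\}$. An $\mathcal F^{\mathrm{fin}}_\theta$-ascent path is $\langle f_\alpha\mid\alpha<\kappa\rangle$, $f_\alpha:\theta\to T_\alpha$, with $\{i\mid f_\alpha(i)\subsetneq f_\beta(i)\}\in\mathcal F^{\mathrm{fin}}_\theta$ for $\alpha<\beta$; injective if some $f_\alpha\restriction I$ is injective with $I\in\mathcal F^{\mathrm{fin}}_\theta$. $E^\kappa_{\ge\chi}=\{\alpha<\kappa\mid\mathrm{cf}(\alpha)\ge\chi\}$. $\mathrm{P}_{14}(\kappa,\sqsubseteq,\kappa,\{S\})$: $\diamondsuit(\kappa)$ holds and there is $\langle C_\alpha\mid\alpha<\kappa\rangle$ with $C_\alpha$ club in $\alpha$ for limit $\alpha$, $C_{\bar\alpha}=C_\alpha\cap\bar\alpha$ for $\bar\alpha\in\mathrm{acc}(C_\alpha)=\{\gamma\in C_\alpha\mid\sup(C_\alpha\cap\gamma)=\gamma>0\}$, and for every sequence $\langle A_i\mid i<\kappa\rangle$ of cofinal subsets of $\kappa$ there are stationarily many $\alpha\in S$ with $\sup\{\beta\in C_\alpha\mid\mathrm{succ}_\omega(C_\alpha\setminus\beta)\subseteq A_i\}=\alpha$ for all $i<\alpha$, where $\mathrm{succ}_\omega(D)=\{\delta\in D\mid0<\mathrm{otp}(D\cap\delta)<\omega\}$. *)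

(* Defs.v *)
Definition card_le (A B : Type) : Prop :=
  exists f : A -> B, forall x y, f x = f y -> x = y.

Definition finite (A : Type) : Prop :=
  exists n : nat, card_le A {m : nat | m < n}.

Section Ordinals.
Context {K : Type} (lt : K -> K -> Prop).

Definition le (a b : K) : Prop := lt a b \/ a = b.

(* the ordinal a viewed as a set: { b | b < a } *)
Definition seg (a : K) : Type := {b : K | lt b a}.

Definition well_order : Prop :=
  well_founded lt /\
  (forall a b c, lt a b -> lt b c -> lt a c) /\
  (forall a b, lt a b \/ a = b \/ lt b a).

(* kappa := otp(K,lt) is a regular uncountable cardinal *)
Definition regular_uncountable : Prop :=
  (forall a : K, ~ card_le K (seg a)) /\
  (forall A : K -> Prop, (forall b, exists c, A c /\ le b c) -> card_le K {x | A x}) /\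
  ~ card_le K nat.

Definition is_card (a : K) : Prop :=
  forall b, lt b a -> ~ card_le (seg a) (seg b).

Definition infinite_ord (a : K) : Prop := card_le nat (seg a).

Definition finite_ord (a : K) : Prop := finite (seg a).

Definition is_succ_card (theta eta : K) : Prop :=
  lt theta eta /\ is_card eta /\
  (forall c, lt theta c -> lt c eta -> ~ is_card c).

(* chi is a cardinal <= kappa: Some c (c < kappa) or None (chi = kappa) *)
Definition below (chi : option K) (b : K) : Prop :=
  match chi with Some c => lt b c | None => True end.

Definition chi_cardinal (chi : option K) : Prop :=
  match chi with Some c => is_card c | None => True end.

Definition small_chi (chi : option K) (X : Type) : Prop :=
  exists c, below chi c /\ card_le X (seg c).

(* lambda^{<chi} < kappa for all lambda < kappa, where
   lambda^{<chi} = | union_{mu < chi} (mu -> lambda) | *)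
Definition exp_hyp (chi : option K) : Prop :=
  forall lam : K, exists a : K,
    card_le {mu : {m : K | below chi m} & (seg (proj1_sig mu) -> seg lam)} (seg a).

Definition sup_is (B : K -> Prop) (a : K) : Prop :=
  (forall b, B b -> le b a) /\ (forall g, lt g a -> exists b, B b /\ lt g b).

Definition nonzero (a : K) : Prop := exists b, lt b a.

Definition is_limit (a : K) : Prop :=
  nonzero a /\ forall b, lt b a -> exists c, lt b c /\ lt c a.

Definition club_in (C : K -> Prop) (a : K) : Prop :=
  (forall b, C b -> lt b a) /\
  (forall b, lt b a -> exists c, C c /\ le b c) /\
  (forall g, lt g a -> nonzero g -> sup_is (fun b => C b /\ lt b g) g -> C g).

Definition club (C : K -> Prop) : Prop :=
  (forall b, exists c, C c /\ le b c) /\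
  (forall g, nonzero g -> sup_is (fun b => C b /\ lt b g) g -> C g).

Definition stationary (S : K -> Prop) : Prop :=
  forall C, club C -> exists a, C a /\ S a.

Definition diamond : Prop :=
  exists D : K -> K -> Prop, forall A : K -> Prop,
    stationary (fun a => forall b, lt b a -> (A b <-> D a b)).

Definition acc (C : K -> Prop) (g : K) : Prop :=
  C g /\ nonzero g /\ sup_is (fun b => C b /\ lt b g) g.

Definition succ_omega (D : K -> Prop) (d : K) : Prop :=
  D d /\ (exists g, D g /\ lt g d) /\ finite {g | D g /\ lt g d}.

Definition E_ge_chi (chi : option K) (a : K) : Prop :=
  forall A : K -> Prop, (forall b, A b -> lt b a) ->
    (forall b, lt b a -> exists c, A c /\ le b c) -> ~ small_chi chi {c | A c}.

Definition P14 (S : K -> Prop) : Prop :=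
  diamond /\
  exists C : K -> K -> Prop,
    (forall a, is_limit a -> club_in (C a) a) /\
    (forall a ab, acc (C a) ab -> forall g, C ab g <-> (C a g /\ lt g ab)) /\
    (forall A : K -> K -> Prop, (forall i b, exists c, A i c /\ le b c) ->
       stationary (fun a => S a /\ forall i, lt i a ->
         sup_is (fun b => C a b /\
                   (forall d, succ_omega (fun g => C a g /\ le b g) d -> A i d)) a)).

Definition node : Type := {a : K & seg a -> K}.
Definition dom (x : node) : K := projT1 x.

Definition sub (x y : node) : Prop :=
  lt (dom x) (dom y) /\
  forall g (h1 : lt g (dom x)) (h2 : lt g (dom y)),
    projT2 x (exist _ g h1) = projT2 y (exist _ g h2).

Definition compat (x y : node) : Prop := x = y \/ sub x y \/ sub y x.

Definition downward_closed (T : node -> Prop) : Prop :=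
  forall x y, T y -> sub x y -> T x.

Definition level (T : node -> Prop) (a : K) : Type := {x : node | T x /\ dom x = a}.

Definition prolific (T : node -> Prop) : Prop :=
  forall x i, T x -> (lt i (dom x) \/ finite_ord i) ->
    exists y, T y /\ sub x y /\ (forall g, lt g (dom y) <-> le g (dom x)) /\
      forall h : lt (dom x) (dom y), projT2 y (exist _ (dom x) h) = i.

Definition slim (T : node -> Prop) : Prop :=
  forall a, card_le (level T a) (seg a + nat).

Definition souslin (T : node -> Prop) : Prop :=
  (forall a, exists x, T x /\ dom x = a) /\
  (forall a, exists b, card_le (level T a) (seg b)) /\
  ~ (exists B : node -> Prop, (forall x, B x -> T x) /\
       (forall x y, B x -> B y -> compat x y) /\
       forall a, exists x, B x /\ dom x = a) /\
  ~ (exists A : node -> Prop, (forall x, A x -> T x) /\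
       (forall x y, A x -> A y -> x <> y -> ~ compat x y) /\
       card_le K {x | A x}).

Definition free (chi : option K) (eta : K) (T : node -> Prop) : Prop :=
  forall tau, below chi tau -> nonzero tau ->
  forall beta (w : seg tau -> node),
    (forall i, T (w i) /\ dom (w i) = beta) ->
    (forall i j, w i = w j -> i = j) ->
  forall A : (seg tau -> node) -> Prop,
    (forall f, A f -> (forall i, T (f i)) /\ (exists d, forall i, dom (f i) = d) /\
                      (forall i, compat (f i) (w i))) ->
    card_le K {f | A f} ->
    exists x y, A x /\ A y /\
      exists c, lt c eta /\ card_le {i : seg tau | ~ sub (x i) (y i)} (seg c).

Definition ascent_path (theta : K) (T : node -> Prop) (f : K -> seg theta -> node) : Prop :=
  (forall a i, T (f a i) /\ dom (f a i) = a) /\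
  (forall a b, lt a b -> finite {i : seg theta | ~ sub (f a i) (f b i)}).

Definition injective_path (theta : K) (f : K -> seg theta -> node) : Prop :=
  exists a (I : seg theta -> Prop), finite {i | ~ I i} /\
    forall i j, I i -> I j -> f a i = f a j -> i = j.

End Ordinals.

(* Main.v *)
(** The tree is built level by level, together with the path [f]. A limit level [alpha] consists of
    the limits of canonical extensions along [C_alpha]: from a level [delta] in [C_alpha], a node
    is moved through the successive points [b < g] of [C_alpha] by step maps from level [b] to
    level [g], and unions are taken at limits; coherence makes these maps independent of [alpha].
    A step normally sends [f_b(j)] to [f_g(j)], so [f_alpha] can be defined as the canonical
    extension of [f_delta], [delta] being the first point of [C_alpha] above [theta]. It also
    obeys the diamond guess at [g], a vector [z] at some level of [C_alpha] and a family [A]: if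
    some member of [A] lies above the image of [z] at level [b], the images of the [z_i] are
    sent above the coordinates of such a member, except for those on the path (at most [theta]
    many) other than the first coordinate. Only one value of the path is disturbed at each step,
    so finitely many before each limit, where [f] is reset to the canonical extension.

    If [cf(alpha) >= chi], each vector of length [tau < chi] at level [alpha] is canonical from
    one level [delta] on, and the proxy principle provides a step of [C_alpha] with the right
    guess. So every family of [kappa] many vectors contains [x], [y] with [x_i] below [y_i]
    for the first [i] and for all but [theta] many [i]: this is freeness, and for [tau = 1] it
    excludes large antichains. As the path cannot be injective before there is room for
    [theta] successors, it starts at level [theta + 1]. *)

From Stdlib Require Import Classical ClassicalEpsilon FunctionalExtensionality PropExtensionality.
From Stdlib Require Import ProofIrrelevance Arith Lia List FinFun Cantor Relation_Operators Wellfounded.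
Require Import Defs.

Local Notation dec := excluded_middle_informative.

(* [P g] sees the values below [g] only, through its dependent argument, while existence
   is asked for restrictions of total functions: no locality condition has to be checked. *)
Lemma wf_build (X R : Type) (lt : X -> X -> Prop) (wf : well_founded lt) (r0 : R)
  (P : forall g, (forall b, lt b g -> R) -> R -> Prop) :
  (forall g (s : X -> R), (forall b, lt b g -> P b (fun c _ => s c) (s b)) ->
     exists r, P g (fun c _ => s c) r) ->
  exists s : X -> R, forall g, P g (fun c _ => s c) (s g).
Proof.
  intros H.
  set (F := fun g (p : forall b, lt b g -> R) => epsilon (inhabits r0) (P g p)).
  exists (Fix wf (fun _ => R) F).
  intros g. induction g as [g IH] using (well_founded_induction wf).
  destruct (H g _ IH) as [r Hr].
  rewrite (Fix_eq wf (fun _ => R) F).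
  - unfold F at 2. apply epsilon_spec. exists r. exact Hr.
  - intros x p q E. replace q with p; auto.
    apply functional_extensionality_dep; intros y.
    apply functional_extensionality_dep; intros h. apply E.
Qed.

Lemma sig_eq (A : Type) (P : A -> Prop) (x y : {a | P a}) : proj1_sig x = proj1_sig y -> x = y.
Proof. destruct x, y; simpl; intros; subst. f_equal. apply proof_irrelevance. Qed.

Lemma choice_on (A B : Type) (b0 : B) (P : A -> Prop) (R : A -> B -> Prop) :
  (forall a, P a -> exists b, R a b) -> exists f : A -> B, forall a, P a -> R a (f a).
Proof.
  intros H. exists (fun a => epsilon (inhabits b0) (R a)).
  intros a Ha. apply epsilon_spec. auto.
Qed.

(** * Cardinal comparisons *)

Lemma card_le_refl (A : Type) : card_le A A.
Proof. exists (fun x => x). auto. Qed.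

Lemma card_le_trans (A B C : Type) : card_le A B -> card_le B C -> card_le A C.
Proof. intros [f Hf] [g Hg]. exists (fun x => g (f x)). auto. Qed.

(** Most injections below are easier to give as relations that are total on the left and determine
    their left argument; no function on a subset type has to be written. *)
Lemma card_le_rel (A B : Type) (R : A -> B -> Prop) :
  (forall a, exists b, R a b) -> (forall a a' b, R a b -> R a' b -> a = a') -> card_le A B.
Proof.
  intros H1 H2. exists (fun a => proj1_sig (constructive_indefinite_description _ (H1 a))).
  intros x y. destruct (constructive_indefinite_description _ (H1 x)),
    (constructive_indefinite_description _ (H1 y)); simpl. intros; subst. eauto.
Qed.

Lemma card_le_subset (A : Type) (P Q : A -> Prop) :
  (forall a, P a -> Q a) -> card_le {a | P a} {a | Q a}.
Proof.
  intros H. exists (fun x => exist Q (proj1_sig x) (H _ (proj2_sig x))).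
  intros x y E. apply sig_eq. inversion E. auto.
Qed.

Lemma card_le_sig (A : Type) (P : A -> Prop) : card_le {a | P a} A.
Proof. exists (@proj1_sig _ _). intros; apply sig_eq; auto. Qed.

Lemma card_le_prod (A B A' B' : Type) :
  card_le A A' -> card_le B B' -> card_le (A * B) (A' * B').
Proof.
  intros [f Hf] [g Hg]. exists (fun p => (f (fst p), g (snd p))).
  intros [a b] [a' b'] E; inversion E. f_equal; auto.
Qed.

Lemma card_le_sum (A B A' B' : Type) :
  card_le A A' -> card_le B B' -> card_le (A + B) (A' + B').
Proof.
  intros [f Hf] [g Hg].
  exists (fun p => match p with inl a => inl (f a) | inr b => inr (g b) end).
  intros [a|b] [a'|b'] E; inversion E; f_equal; auto.
Qed.

Lemma card_le_sigma (A B : Type) (Z : A -> Type) : (forall a, card_le (Z a) B) -> card_le {a & Z a} (A * B).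
Proof.
  intros H.
  apply (card_le_rel _ _ (fun x p => fst p = projT1 x /\
    snd p = proj1_sig (constructive_indefinite_description _ (H (projT1 x))) (projT2 x))).
  - intros x. eexists (_, _). simpl. eauto.
  - intros [a x] [a' x'] [p q]; simpl. intros [E1 E2] [E3 E4]. subst p. subst a'.
    destruct (constructive_indefinite_description _ (H a)) as [f Hf]; simpl in *.
    f_equal. apply Hf. congruence.
Qed.

Lemma card_le_nat_square : card_le (nat * nat) nat.
Proof.
  exists Cantor.to_nat. intros x y E.
  rewrite <- (Cantor.cancel_of_to x), <- (Cantor.cancel_of_to y), E. reflexivity.
Qed.

Lemma nat_not_finite : ~ finite nat.
Proof.
  intros [n [f Hf]].
  assert (L : length (map (fun k => proj1_sig (f k)) (seq 0 (S n))) <= length (seq 0 n)).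
  { apply NoDup_incl_length.
    - apply Injective_map_NoDup; [|apply seq_NoDup].
      intros x y E. apply Hf, sig_eq, E.
    - intros x Hx. apply in_map_iff in Hx as [k [<- _]].
      apply in_seq. destruct (f k); simpl; lia. }
  rewrite length_map, !length_seq in L. lia.
Qed.

Lemma finite_mono (A B : Type) : card_le A B -> finite B -> finite A.
Proof. intros H [n Hn]. exists n. eapply card_le_trans; eauto. Qed.

Lemma finite_or (A : Type) (P Q : A -> Prop) :
  finite {a | P a} -> finite {a | Q a} -> finite {a | P a \/ Q a}.
Proof.
  intros [n [f Hf]] [m [g Hg]]. exists (n + m).
  apply (card_le_rel _ _ (fun x k =>
    (exists h : P (proj1_sig x), proj1_sig k = proj1_sig (f (exist _ _ h))) \/
    (exists h : Q (proj1_sig x), proj1_sig k = n + proj1_sig (g (exist _ _ h))))).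
  - intros [a [h|h]]; simpl.
    + destruct (f (exist _ a h)) as [k Hk] eqn:E.
      assert (Hk' : k < n + m) by lia. exists (exist _ k Hk'). left. exists h. rewrite E. auto.
    + destruct (g (exist _ a h)) as [k Hk] eqn:E.
      assert (Hk' : n + k < n + m) by lia. exists (exist _ (n + k) Hk').
      right. exists h. rewrite E. auto.
  - intros [a Ha] [b Hb] [k Hk]; simpl. intros [[h E]|[h E]] [[h' E']|[h' E']]; apply sig_eq; simpl.
    + rewrite E in E'. apply sig_eq, Hf in E'. inversion E'; auto.
    + destruct (f (exist _ a h)); simpl in *; lia.
    + destruct (f (exist _ b h')); simpl in *; lia.
    + rewrite E in E'. apply Nat.add_cancel_l in E'. apply sig_eq, Hg in E'. inversion E'; auto.
Qed.

Lemma finite_subset (A : Type) (P Q : A -> Prop) :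
  (forall a, P a -> Q a) -> finite {a | Q a} -> finite {a | P a}.
Proof. intros H. apply finite_mono, card_le_subset, H. Qed.

Lemma finite_at_most_one (A : Type) (P : A -> Prop) :
  (forall a b, P a -> P b -> a = b) -> finite {a | P a}.
Proof.
  intros H. exists 1. exists (fun _ => exist (fun m => m < 1) 0 Nat.lt_0_1).
  intros [a Ha] [b Hb] _. apply sig_eq. simpl. auto.
Qed.

(** Values are chosen by recursion along [R], each different from all earlier ones. If none were
    left at [x], choosing for each [v] an earlier point with value [v] would inject [Y] into the
    predecessors of [x]. *)
Lemma greedy_injection (X Y : Type) (R : X -> X -> Prop) :
  well_founded R -> (forall x y, R x y \/ x = y \/ R y x) ->
  (forall x, ~ card_le Y {y | R y x}) -> card_le X Y.
Proof.
  intros wf tot H.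
  assert (N : forall x (s : X -> Y), exists v, forall y, R y x -> s y <> v).
  { intros x s. apply NNPP. intros C. apply (H x).
    apply (card_le_rel _ _ (fun v y => s (proj1_sig y) = v)).
    - intros v. apply NNPP. intros C'. apply C. exists v. intros y h E.
      apply C'. exists (exist _ y h). auto.
    - intros; congruence. }
  destruct (classic (exists x : X, True)) as [[x0 _]|E].
  2:{ exists (fun x => False_rect _ (E (ex_intro _ x I))). intros x. destruct E; eauto. }
  assert (y0 : inhabited Y).
  { apply NNPP. intros C. apply (H x0). exists (fun y => False_rect _ (C (inhabits y))).
    intros y. destruct (C (inhabits y)). }
  destruct y0 as [y0].
  destruct (wf_build X Y R wf y0 (fun g s r => forall b h, s b h <> r)) as [s Hs].
  { intros g s _. apply N. }
  exists s. intros x y E. destruct (tot x y) as [h|[h|h]]; auto; exfalso; eapply Hs; eauto.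
Qed.

(* Goedel's order on pairs: by the maximum, then lexicographically. *)
Section Square.
Variables (W : Type) (lt : W -> W -> Prop).
Hypothesis wo : well_order lt.

Let mx (p : W * W) : W := if dec (lt (fst p) (snd p)) then snd p else fst p.

(** In Goedel's order the predecessors of [q] lie in the square of the closed segment up to [mx q],
    so the greedy injection never runs out of values. *)
Lemma card_le_square_of_segments (Y : Type) :
  (forall m, ~ card_le Y ({w | le lt w m} * {w | le lt w m})) -> card_le (W * W) Y.
Proof.
  destruct wo as [wf [tr tot]]. intros H.
  apply (greedy_injection _ _
    (fun p q => slexprod _ _ lt (slexprod _ _ lt lt) (mx p, p) (mx q, q))).
  - apply (wf_inverse_image _ _ _ (fun p => (mx p, p))).
    apply wf_slexprod; auto. apply wf_slexprod; auto.
  - intros p q. destruct (tot (mx p) (mx q)) as [h|[h|h]].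
    + left. left. auto.
    + rewrite h. destruct p as [a b], q as [c d].
      destruct (tot a c) as [k|[k|k]].
      * left. right. left. auto.
      * subst. destruct (tot b d) as [k|[k|k]].
        -- left. right. right. auto.
        -- subst. auto.
        -- right; right. right. right. auto.
      * right; right. right. left. auto.
    + right; right. left. auto.
  - intros q C. apply (H (mx q)). eapply card_le_trans; [exact C|].
    assert (B : forall p, slexprod _ _ lt (slexprod _ _ lt lt) (mx p, p) (mx q, q) ->
              le lt (fst p) (mx q) /\ le lt (snd p) (mx q)).
    { intros p Hp. assert (Hm : le lt (mx p) (mx q)) by (inversion Hp; unfold le; auto).
      assert (le lt (fst p) (mx p) /\ le lt (snd p) (mx p)) as [A1 A2].
      { unfold mx. destruct (dec (lt (fst p) (snd p))); unfold le; split; auto.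
        destruct (tot (fst p) (snd p)) as [?|[?|?]]; intuition. }
      unfold le in *. intuition (try congruence); eauto; left; congruence. }
    exists (fun p => (exist (fun w => le lt w (mx q)) _ (proj1 (B _ (proj2_sig p))),
                      exist (fun w => le lt w (mx q)) _ (proj2 (B _ (proj2_sig p))))).
    intros [[a b] Hp] [[c d] Hq] E. inversion E. apply sig_eq. simpl in *. congruence.
Qed.
End Square.

(** * Ordinals below a regular cardinal *)

Section Ord.
Variables (K : Type) (lt : K -> K -> Prop).
Hypothesis wo : well_order lt.
Local Notation "a < b" := (lt a b).
Local Notation "a <= b" := (le lt a b).
Local Notation seg := (seg lt).

Lemma lt_wf : well_founded lt. Proof. apply wo. Qed.
Lemma lt_tr a b c : a < b -> b < c -> a < c. Proof. apply wo. Qed.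
Lemma lt_tot a b : a < b \/ a = b \/ b < a. Proof. apply wo. Qed.
Lemma lt_irr a : ~ a < a.
Proof. induction a as [a IH] using (well_founded_induction lt_wf). intros h. eapply IH; eauto. Qed.
Lemma le_lt_tr a b c : a <= b -> b < c -> a < c.
Proof. intros [h|<-] k; auto. eapply lt_tr; eauto. Qed.
Lemma lt_le_tr a b c : a < b -> b <= c -> a < c.
Proof. intros h [k|<-]; auto. eapply lt_tr; eauto. Qed.
Lemma le_tr a b c : a <= b -> b <= c -> a <= c.
Proof. intros [h|<-] k; auto. left. eapply lt_le_tr; eauto. Qed.
Lemma not_lt a b : ~ a < b <-> b <= a.
Proof.
  split; [destruct (lt_tot a b) as [h|[h|h]]; unfold le; intuition congruence|].
  intros h k. apply (lt_irr b). eapply le_lt_tr; eauto.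
Qed.
Lemma not_le a b : ~ a <= b <-> b < a.
Proof.
  rewrite <- (not_lt b a). split; [apply NNPP | tauto].
Qed.
Lemma le_total a b : a <= b \/ b <= a.
Proof. destruct (lt_tot a b) as [h|[h|h]]; unfold le; auto. Qed.
Lemma le_antisym a b : a <= b -> b <= a -> a = b.
Proof. intros [h|h] k; auto. destruct (lt_irr a). eapply lt_le_tr; eauto. Qed.

Lemma least (A : K -> Prop) : (exists a, A a) -> exists a, A a /\ forall b, A b -> a <= b.
Proof.
  intros [a Ha]. apply NNPP. intros C.
  revert Ha. induction a as [a IH] using (well_founded_induction lt_wf). intros Ha.
  apply C. exists a. split; auto. intros b Hb. apply not_lt. intros h. exact (IH b h Hb).
Qed.

Lemma max2 a b : exists c, a <= c /\ b <= c.
Proof. destruct (le_total a b); [exists b | exists a]; split; auto; right; auto. Qed.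

Lemma seg_mono a b : a <= b -> card_le (seg a) (seg b).
Proof. intros h. apply card_le_subset. intros c k. eapply lt_le_tr; eauto. Qed.

(** The size is the maximum of [|a|] and aleph zero, the bound in the definition of slimness. *)
Definition stock (a : K) : Type := (seg a + nat)%type.

Lemma stock_mono a b : a <= b -> card_le (stock a) (stock b).
Proof. intros h. apply card_le_sum; [apply seg_mono; auto | apply card_le_refl]. Qed.

Lemma nat_le_stock a : card_le nat (stock a).
Proof. exists inr. intros x y E; inversion E; auto. Qed.

Lemma seg_le_stock a : card_le (seg a) (stock a).
Proof. exists inl. intros x y E; inversion E; auto. Qed.

Lemma closed_seg_le_stock m : card_le {w | w <= m} (stock m).
Proof.
  exists (fun w => match dec (proj1_sig w < m) with
    | left h => inl (exist (fun b => b < m) _ h) | right _ => inr 0 end).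
  intros [x Hx] [y Hy]; simpl.
  destruct (dec (x < m)), (dec (y < m)); intros E; inversion E; apply sig_eq; simpl; auto.
  destruct Hx, Hy; try tauto. congruence.
Qed.

(** Hessenberg's theorem, by induction. Unless [stock a] is countable or embeds in an earlier stock,
    all its closed segments are smaller than it, and so are their squares. *)
Theorem stock_square a : card_le (stock a * stock a) (stock a).
Proof.
  induction a as [a IH] using (well_founded_induction lt_wf).
  destruct (classic (card_le (stock a) nat)) as [Hn|Hn].
  { eapply card_le_trans; [apply card_le_prod; exact Hn|].
    eapply card_le_trans; [apply card_le_nat_square|]. apply nat_le_stock. }
  destruct (classic (exists b, b < a /\ card_le (stock a) (stock b))) as [[b [h Hb]]|Hb].
  { eapply card_le_trans; [apply card_le_prod; exact Hb|].
    eapply card_le_trans; [apply IH; auto|]. apply stock_mono. left; auto. }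
  (* The order type is omega followed by [a], so that closed segments are countable or covered by an
     earlier stock. *)
  set (slt := fun x y : stock a => match x, y with
    | inr n, inr k => (n < k)%nat | inr _, inl _ => True | inl _, inr _ => False
    | inl b, inl c => proj1_sig b < proj1_sig c end).
  assert (A1 : forall n, Acc slt (inr n)).
  { intros n. induction n as [n IHn] using lt_wf_ind. constructor.
    intros [b|k]; simpl; [tauto | intros; apply IHn; auto]. }
  assert (A2 : forall b h, Acc slt (inl (exist _ b h))).
  { intros b. induction b as [b IHb] using (well_founded_induction lt_wf). intros h.
    constructor. intros [[c k]|k]; simpl; intros; auto. }
  apply (card_le_square_of_segments _ slt).
  - split; [|split].
    + intros [[b h]|n]; auto.
    + intros [[x hx]|x] [[y hy]|y] [[z hz]|z]; simpl; try tauto; try lia. apply lt_tr.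
    + intros [[x hx]|x] [[y hy]|y]; simpl; auto.
      * destruct (lt_tot x y) as [h|[h|h]]; auto. right; left. f_equal. apply sig_eq; auto.
      * destruct (Nat.lt_trichotomy x y) as [h|[h|h]]; auto.
  - intros [[b h]|n] C.
    + apply Hb. exists b. split; auto. eapply card_le_trans; [exact C|].
      eapply card_le_trans; [|apply IH; exact h].
      (* The point [b] is sent to 0, and the natural numbers are shifted by one to make room for
         it. *)
      assert (Q : card_le {w : stock a | le slt w (inl (exist _ b h))} (stock b)).
      { apply (card_le_rel _ _ (fun w v => match proj1_sig w, v with
          | inl c, inl d => proj1_sig c = proj1_sig d
          | inl c, inr n => proj1_sig c = b /\ n = 0
          | inr k, inr n => n = S k | inr _, inl _ => False end)).
        - intros [[[c k]|k] [Hw|Hw]]; simpl in *.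
          + exists (inl (exist _ c Hw)). auto.
          + inversion Hw. exists (inr 0). auto.
          + exists (inr (S k)). auto.
          + exists (inr (S k)). auto.
        - intros [[[c k]|k] Hw] [[[c' k']|k'] Hw'] [[d l]|d]; simpl in *; intros; try tauto;
            apply sig_eq; simpl; f_equal; try (apply sig_eq; simpl); try lia; intuition congruence. }
      apply card_le_prod; auto.
    + apply Hn. eapply card_le_trans; [exact C|].
      eapply card_le_trans; [|apply card_le_nat_square].
      assert (Q : card_le {w : stock a | le slt w (inr n)} nat).
      { apply (card_le_rel _ _ (fun w v => match proj1_sig w with
          | inl c => False | inr k => v = k end)).
        - intros [[[c k]|k] [Hw|Hw]]; simpl in *; try tauto; try congruence; eauto.
        - intros [[[c k]|k] Hw] [[[c' k']|k'] Hw'] v; simpl in *; intros; try tauto.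
          apply sig_eq; simpl. congruence. }
      apply card_le_prod; auto.
Qed.

Lemma finite_ords_countable : card_le {i | finite_ord lt i} nat.
Proof.
  apply (greedy_injection _ _ (fun x y => proj1_sig x < proj1_sig y)).
  - apply (wf_inverse_image _ _ _ (fun x => proj1_sig x)). apply lt_wf.
  - intros x y. destruct (lt_tot (proj1_sig x) (proj1_sig y)) as [h|[h|h]]; auto.
    right; left. apply sig_eq; auto.
  - intros [i Hi] C. simpl in C. apply nat_not_finite.
    eapply finite_mono; [exact C|]. eapply finite_mono; [|exact Hi].
    exists (fun x => exist (fun b => b < i) (proj1_sig (proj1_sig x)) (proj2_sig x)).
    intros x y E. inversion E. apply sig_eq, sig_eq. auto.
Qed.

(** * Sets of size below kappa, and clubs of closure points *)

Section Reg.
Hypothesis reg : regular_uncountable lt.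

(** Size below [kappa]. For types that embed in [K], a bound by a segment is recovered in
    [small_into_K]. *)
Definition small (Y : Type) : Prop := ~ card_le K Y.

Lemma small_mono (X Y : Type) : card_le X Y -> small Y -> small X.
Proof. intros h k c. apply k. eapply card_le_trans; eauto. Qed.

Lemma small_seg a : small (seg a). Proof. apply reg. Qed.

Lemma small_nat : small nat. Proof. apply reg. Qed.

Lemma small_bounded (A : K -> Prop) : small {x | A x} -> exists b, forall x, A x -> x < b.
Proof.
  intros H. apply NNPP. intros C. apply H. apply reg. intros b.
  apply NNPP. intros C'. apply C. exists b. intros x Hx. apply not_le. intros h.
  apply C'. eauto.
Qed.

Lemma small_image_bounded (Y : Type) (h : Y -> K) : small Y -> exists b, forall y, h y < b.
Proof.
  intros H. destruct (small_bounded (fun x => exists y, h y = x)) as [b Hb]; [|eauto].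
  eapply small_mono; [|exact H].
  apply (card_le_rel _ _ (fun x y => h y = proj1_sig x)).
  - intros [x [y E]]. eauto.
  - intros x x' y E E'. apply sig_eq. congruence.
Qed.

Lemma small_rel_bounded (Y : Type) (R : Y -> K -> Prop) :
  small Y -> exists b, forall y, (exists x, R y x) -> exists x, R y x /\ x < b.
Proof.
  intros H. destruct (small_image_bounded {y | exists x, R y x}
    (fun y => proj1_sig (constructive_indefinite_description _ (proj2_sig y)))) as [b Hb].
  { eapply small_mono; [apply card_le_sig|auto]. }
  exists b. intros y E. specialize (Hb (exist _ y E)).
  destruct (constructive_indefinite_description _ _); simpl in *. eauto.
Qed.

(** Under an injection [g] of [K] the points sent to the fibre at [y] are bounded by some [h y], and
    all [h y] by one [b]. The fibre containing the image of [b] contradicts this. *)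
Lemma small_sigma (Y : Type) (Z : Y -> Type) :
  small Y -> (forall y, small (Z y)) -> small {y & Z y}.
Proof.
  intros HY HZ [g Hg].
  assert (B : forall y, exists b, forall x, projT1 (g x) = y -> x < b).
  { intros y. apply small_bounded. apply (small_mono _ (Z y)); auto.
    apply (card_le_rel _ _ (fun x z => g (proj1_sig x) = existT _ y z)).
    - intros [x E]; simpl. destruct (g x) as [y' z]; simpl in E. subst. eauto.
    - intros x x' z E E'. apply sig_eq, Hg. congruence. }
  destruct (choice (fun y b => forall x, projT1 (g x) = y -> x < b) B) as [h Hh].
  destruct (small_image_bounded Y h HY) as [b Hb].
  apply (lt_irr b). eapply lt_tr; [|apply (Hb (projT1 (g b)))]. apply Hh. auto.
Qed.

Lemma small_stock a : small (stock a).
Proof.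
  apply (small_mono _ {b : bool & if b then seg a else nat}).
  - exists (fun x => match x with inl y => existT (fun b : bool => if b then seg a else nat) true y
       | inr y => existT _ false y end).
    intros [x|x] [y|y] E; try discriminate E; f_equal; apply inj_pairT2 in E; auto.
  - apply small_sigma; [|intros []; [apply small_seg | apply small_nat]].
    apply (small_mono _ nat); [|apply small_nat].
    exists (fun b : bool => if b then 0 else 1). intros [] []; congruence.
Qed.

Lemma no_max a : exists b, a < b.
Proof.
  destruct (small_bounded (fun x => x <= a)) as [b Hb].
  - eapply small_mono; [apply closed_seg_le_stock|apply small_stock].
  - exists b. apply Hb. right; auto.
Qed.

Lemma small_into_K (Y : Type) : card_le Y K -> small Y -> exists a, card_le Y (seg a).
Proof.
  intros [f Hf] H. destruct (small_image_bounded Y f H) as [b Hb]. exists b.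
  exists (fun y => exist _ (f y) (Hb y)). intros x y E. inversion E; auto.
Qed.

Lemma K_square : card_le (K * K) K.
Proof.
  apply (card_le_square_of_segments _ lt wo). intros m. apply (small_mono _ (stock m)).
  - eapply card_le_trans; [apply card_le_prod; apply closed_seg_le_stock|apply stock_square].
  - apply small_stock.
Qed.

Lemma succ_exists a : exists b, forall c, c < b <-> c <= a.
Proof.
  destruct (least _ (no_max a)) as [b [h Hb]]. exists b. intros c. split; intros k.
  - apply not_lt. intros l. apply Hb in l. revert k. apply not_lt. auto.
  - eapply le_lt_tr; eauto.
Qed.

Lemma sup_exists (A : K -> Prop) b : (forall a, A a -> a <= b) ->
  exists s, (forall a, A a -> a <= s) /\ forall c, (forall a, A a -> a <= c) -> s <= c.
Proof. intros H. apply (least (fun s => forall a, A a -> a <= s)). eauto. Qed.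

(** Unboundedness: iterate a strictly increasing bound for [h] omega times. Regularity and
    uncountability put the limit of the iteration below [kappa], and each point below it is below
    some iterate. *)
Lemma club_closure_points (h : K -> K) :
  club lt (fun b => nonzero lt b /\ forall d, d < b -> h d < b).
Proof.
  split.
  - intros b.
    assert (N : forall a, exists c, a < c /\ forall d, d < a -> h d < c).
    { intros a. destruct (small_image_bounded (seg a) (fun x => h (proj1_sig x)) (small_seg a)) as [c Hc].
      destruct (no_max a) as [a' Ha]. destruct (max2 c a') as [e [h1 h2]]. exists e. split.
      - eapply lt_le_tr; eauto.
      - intros d Hd. eapply lt_le_tr; [|exact h1]. apply (Hc (exist _ d Hd)). }
    destruct (choice _ N) as [n Hn].
    set (u := fix u k := match k with 0 => b | S k => n (u k) end).
    destruct (small_image_bounded nat u small_nat) as [t Ht].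
    destruct (least (fun s => forall k, u k < s)) as [s [Hs Hm]]; [exists t; auto|].
    exists s. split; [|left; apply (Hs 0)]. split; [exists b; apply (Hs 0)|].
    intros d Hd. assert (E : exists k, d < u k).
    { apply NNPP. intros C.
      assert (Hd' : s <= d).
      { apply Hm. intros k. eapply lt_le_tr; [apply (proj1 (Hn (u k)))|].
        apply not_lt. intros l. apply C. exists (S k). exact l. }
      apply (lt_irr d). eapply lt_le_tr; eauto. }
    destruct E as [k Hk]. eapply lt_tr; [|apply (Hs (S k))]. apply Hn. auto.
  - intros g Hg [_ H]. split; auto. intros d Hd. destruct (H d Hd) as [b [[[_ Hb] k] l]].
    eapply lt_tr; [apply Hb; auto|auto].
Qed.

Lemma stationary_cofinal (S : K -> Prop) : stationary lt S -> forall b, exists c, S c /\ b <= c.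
Proof.
  intros H b. destruct (H _ (club_closure_points (fun _ => b))) as [c [[[z Hz] Hc] Sc]].
  exists c. split; auto. left. eauto.
Qed.

(** * Nodes and their coding *)

Local Notation node := (node lt).
Local Notation dom := (dom lt).
Local Notation sub := (sub lt).

(* The value of [x] at [c] outside its domain is junk. *)
Definition val (x : node) (c : K) : K :=
  match dec (c < dom x) with left h => projT2 x (exist _ c h) | right _ => c end.

Definition mk (b : K) (u : K -> K) : node := existT _ b (fun c => u (proj1_sig c)).

(** The reflexive version of [sub], free of membership proofs because [val] is total. *)
Definition pre (x y : node) : Prop := dom x <= dom y /\ forall c, c < dom x -> val x c = val y c.

Definition restr (x : node) (b : K) : node := mk b (val x).

Lemma val_in x c (h : c < dom x) : val x c = projT2 x (exist _ c h).
Proof.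
  unfold val. destruct (dec (c < dom x)) as [k|k]; [|tauto].
  f_equal. apply sig_eq; auto.
Qed.

Lemma val_mk b u c : c < b -> val (mk b u) c = u c.
Proof. intros h. rewrite (val_in (mk b u) c h). reflexivity. Qed.

Lemma node_ext x y : dom x = dom y -> (forall c, c < dom x -> val x c = val y c) -> x = y.
Proof.
  destruct x as [a u], y as [b v]. simpl. intros <- H. f_equal.
  apply functional_extensionality. intros [c h].
  specialize (H c h). rewrite (val_in (existT _ a u) c h), (val_in (existT _ a v) c h) in H. exact H.
Qed.

Lemma sub_pre x y : sub x y <-> pre x y /\ dom x < dom y.
Proof.
  unfold Defs.sub, pre. split.
  - intros [h H]. repeat split; auto. left; auto.
    intros c hc. rewrite (val_in x c hc), (val_in y c (lt_tr _ _ _ hc h)). apply H.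
  - intros [[_ H] h]. split; auto. intros c h1 h2. rewrite <- !val_in. auto.
Qed.

Lemma pre_refl x : pre x x.
Proof. split; auto. right; auto. Qed.

Lemma pre_tr x y z : pre x y -> pre y z -> pre x z.
Proof.
  intros [h1 H1] [h2 H2]. split; [eapply le_tr; eauto|].
  intros c hc. rewrite H1, H2; auto. eapply lt_le_tr; eauto.
Qed.

Lemma pre_eq x y : pre x y -> dom x = dom y -> x = y.
Proof. intros [_ H] E. apply node_ext; auto. Qed.

Lemma pre_common x y z : pre x z -> pre y z -> dom x <= dom y -> pre x y.
Proof.
  intros [h1 H1] [h2 H2] h. split; auto. intros c hc. rewrite H1, H2; auto.
  eapply lt_le_tr; eauto.
Qed.

Lemma restr_pre x b : b <= dom x -> pre (restr x b) x.
Proof. intros h. split; auto. intros c hc. apply val_mk. auto. Qed.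

Lemma pre_restr y x : pre y x -> y = restr x (dom y).
Proof.
  intros [h H]. apply node_ext; auto. intros c hc. unfold restr. rewrite val_mk; auto.
Qed.

Lemma pre_restr_eq y x b : pre y x -> dom y = b -> restr x b = y.
Proof. intros h <-. symmetry. apply pre_restr; auto. Qed.

Lemma restr_of_pre z y b : pre z y -> b <= dom z -> restr y b = restr z b.
Proof.
  intros h k. apply pre_restr_eq; auto. eapply pre_tr; [|exact h]. apply restr_pre; auto.
Qed.

Lemma compat_pre x y : compat lt x y -> dom x <= dom y -> pre x y.
Proof.
  intros [->|[h|h]] k; [apply pre_refl | apply sub_pre in h; tauto|].
  apply sub_pre in h as [_ h]. destruct (lt_irr (dom x)). eapply le_lt_tr; eauto.
Qed.

Lemma compat_sym x y : compat lt x y -> compat lt y x.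
Proof. unfold compat. intuition. Qed.

Lemma chain_union (D : K -> Prop) g (N : K -> node) :
  (forall c, c < g -> exists e, D e /\ c < e) -> (forall e, D e -> e < g) ->
  (forall e, D e -> dom (N e) = e) ->
  (forall e e', D e -> D e' -> e <= e' -> pre (N e) (N e')) ->
  exists y, dom y = g /\ forall e, D e -> pre (N e) y.
Proof.
  intros Hc Hg Hd Hp.
  (* The value of the union at [c] is read off at a chosen level [m c] above [c]. *)
  destruct (choice_on _ _ g (fun c => c < g) _ Hc) as [m Hm].
  exists (mk g (fun c => val (N (m c)) c)). split; auto.
  intros e He. split; simpl; [rewrite Hd; auto; left; auto|].
  rewrite Hd; auto. intros c h. assert (h' : c < g) by (eapply lt_tr; eauto).
  rewrite val_mk; auto. destruct (Hm c h') as [k l].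
  destruct (le_total e (m c)) as [q|q].
  - apply Hp; auto. rewrite Hd; auto.
  - symmetry. apply Hp; auto. rewrite Hd; auto.
Qed.

Lemma node_eq_of_cofinal g x y :
  dom x = g -> dom y = g -> (forall c, c < g -> exists z, c < dom z /\ pre z x /\ pre z y) -> x = y.
Proof.
  intros Hx Hy H. apply node_ext; [congruence|]. rewrite Hx. intros c h.
  destruct (H c h) as [z [k [[_ h1] [_ h2]]]]. rewrite <- h1, <- h2; auto.
Qed.

(** * Coding vectors by ordinals, and guessing them *)

Section Diamond.
Hypothesis dia : diamond lt.

(* Diamond implies [2^{<kappa} = kappa]: every bounded subset of [kappa] is guessed, hence
   equals some [D a] below [a]. A node is determined by its coded graph. *)
Lemma node_into_K : card_le node K.
Proof.
  destruct dia as [D HD]. destruct (K_square) as [pr Hpr].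
  set (S := fun (x : node) k => exists c, c < dom x /\ k = pr (c, val x c)).
  apply (card_le_rel _ _ (fun x a => (forall k, S x k -> k < a) /\ forall k, k < a -> (S x k <-> D a k))).
  - intros x.
    destruct (small_image_bounded _ (fun c : seg (dom x) => pr (proj1_sig c, val x (proj1_sig c)))
      (small_seg _)) as [b Hb].
    destruct (stationary_cofinal _ (HD (S x)) b) as [a [Ha h]].
    exists a. split; auto. intros k [c [hc ->]]. eapply lt_le_tr; [|exact h].
    apply (Hb (exist _ c hc)).
  - assert (N : forall x y a, ((forall k, S x k -> k < a) /\ forall k, k < a -> (S x k <-> D a k)) ->
       ((forall k, S y k -> k < a) /\ forall k, k < a -> (S y k <-> D a k)) -> pre x y).
    { intros x y a [h1 h2] [h3 h4].
      assert (B : forall c, c < dom x -> c < dom y /\ val x c = val y c).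
      { intros c hc. assert (Sx : S x (pr (c, val x c))) by (exists c; auto).
        assert (Sy : S y (pr (c, val x c))) by (apply h4; auto; apply h2; auto).
        destruct Sy as [c' [hc' E]]. apply Hpr in E. inversion E; subst. auto. }
      split.
      - apply not_lt. intros h. apply (lt_irr (dom y)). apply B; auto.
      - intros c hc. apply B; auto. }
    intros x y a h1 h2. apply pre_eq; [eauto|]. apply le_antisym; [apply (N x y a)|apply (N y x a)]; auto.
Qed.

(** Composing with an injection of nodes into [K] turns a vector of nodes into a single node. *)
Lemma vectors_into_K : card_le {tau : K & seg tau -> node} K.
Proof.
  eapply card_le_trans; [|apply node_into_K]. destruct node_into_K as [e He].
  exists (fun v : {tau : K & seg tau -> node} => existT _ (projT1 v) (fun i => e (projT2 v i)) : node).
  intros [t v] [t' v'] E. simpl in E. assert (t = t') by (inversion E; auto). subst t'.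
  apply inj_pairT2 in E. f_equal. apply functional_extensionality. intros i.
  apply He. exact (f_equal (fun u => u i) E).
Qed.

(** A single guessed set carries both the vector [z] and the family [A], under different tags.
    Correct guesses occur stationarily often, so one is found at a point [g] above [b] and closed
    under [h]. *)
Lemma diamond_guess :
  exists (e : forall tau, (seg tau -> node) -> K)
    (Gz Ga : K -> forall tau, (seg tau -> node) -> Prop),
  (forall t v t' v', e t v = e t' v' ->
     existT (fun t => seg t -> node) t v = existT (fun t => seg t -> node) t' v') /\
  (forall g t v t' v', Gz g t v -> Gz g t' v' ->
     existT (fun t => seg t -> node) t v = existT (fun t => seg t -> node) t' v') /\
  (forall t z (A : (seg t -> node) -> Prop) (h : K -> K) b,
     exists g, b <= g /\ (forall d, d < g -> h d < g) /\ Gz g t z /\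
       forall v, Ga g t v <-> (A v /\ e t v < g)).
Proof.
  destruct dia as [D HD]. destruct vectors_into_K as [e He]. destruct K_square as [pr Hpr].
  destruct (least (fun _ => True)) as [o _].
  { apply NNPP. intros C. apply small_nat. exists (fun x => False_rect _ (C (ex_intro _ x I))).
    intros x. destruct (C (ex_intro _ x I)). }
  destruct (no_max o) as [o' Ho].
  (* The tags [o] and [o'] keep the code of the vector apart from the codes of the members of the
     family. *)
  set (cl := fun v => pr (o, e v)). set (cr := fun v => pr (o', e v)).
  assert (Hcl : forall v v', cl v = cl v' -> v = v').
  { intros v v' E. apply Hpr in E. apply He. congruence. }
  assert (Hcr : forall v v', cr v = cr v' -> v = v').
  { intros v v' E. apply Hpr in E. apply He. congruence. }
  assert (Hlr : forall v v', cl v <> cr v').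
  { intros v v' E. apply Hpr in E. apply (lt_irr o). congruence. }
  set (P := fun t v => existT (fun t => seg t -> node) t v).
  exists (fun t v => cr (P t v)),
    (* Demanding that the guess contain just one tagged vector makes [Gz] functional even where the
       guess is wrong. *)
    (fun g t z => (cl (P t z) < g /\ D g (cl (P t z))) /\ forall u, cl u < g /\ D g (cl u) -> u = P t z),
    (fun g t v => cr (P t v) < g /\ D g (cr (P t v))).
  split; [|split].
  - intros t v t' v' E. apply Hcr, E.
  - intros g t v t' v' [h1 _] [_ h2]. apply h2, h1.
  - intros t z A h b.
    set (G := fun k => k = cl (P t z) \/ exists v, A v /\ k = cr (P t v)).
    (* A closure point of [h'] is closed under [h] and lies above both [b] and the code of [z]. *)
    assert (N : forall d, exists c, h d <= c /\ b <= c /\ cl (P t z) <= c).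
    { intros d. destruct (max2 (h d) b) as [c1 [? ?]]. destruct (max2 c1 (cl (P t z))) as [c [? ?]].
      exists c. repeat split; auto; eapply le_tr; eauto. }
    destruct (choice _ N) as [h' Hh'].
    destruct (HD G _ (club_closure_points h')) as [g [[[d Hd] Hg] HG]].
    exists g. assert (Hz : cl (P t z) < g) by (eapply le_lt_tr; [apply (Hh' d)|auto]).
    repeat split; auto.
    + left. eapply le_lt_tr; [apply (Hh' d)|auto].
    + intros c hc. eapply le_lt_tr; [apply (Hh' c)|auto].
    + apply HG; auto. left; auto.
    + intros u [h1 h2]. apply HG in h2; auto. destruct h2 as [h2|[v [_ h2]]]; [auto|].
      destruct (Hlr _ _ h2).
    + destruct H as [h1 h2]. apply HG in h2; auto. destruct h2 as [h2|[v' [Av h2]]].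
      * symmetry in h2. destruct (Hlr _ _ h2).
      * apply Hcr, inj_pairT2 in h2. subst; auto.
    + apply H.
    + apply H.
    + apply HG; [apply H|]. right. exists v. split; auto. apply H.
Qed.
End Diamond.

(** * The recursion *)

Section Construction.
Variables (theta : K) (Cs : K -> K -> Prop) (Gz Ga : K -> forall tau, (seg tau -> node) -> Prop).
Hypothesis Cs_club : forall a, is_limit lt a -> club_in lt (Cs a) a.
Hypothesis Cs_coherent :
  forall a b, acc lt (Cs a) b -> forall c, Cs b c <-> (Cs a c /\ c < b).
Hypothesis Gz_functional : forall g t v t' v', Gz g t v -> Gz g t' v' ->
  existT (fun t => seg t -> node) t v = existT (fun t => seg t -> node) t' v'.

(* [lift r D d x] is the canonical extension, along the ladder [D], of a node [x] of
   level [d] in [D] to the level of the stage [r]. A limit level [g] consists of the lifts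
   along [Cs g]. *)
Record stage : Type := Stage {
  nodes : node -> Prop;
  path : seg theta -> node;
  lift : (K -> Prop) -> K -> node -> node }.

(* The ladders that matter are the sets [Cs a], for limit [a], taken below any [g <= a]. *)
Definition ladder (g : K) (D : K -> Prop) : Prop :=
  (forall e, e < g -> nonzero lt e -> sup_is lt (fun b => D b /\ b < e) e -> D e) /\
  (forall e, e <= g -> nonzero lt e -> sup_is lt (fun b => D b /\ b < e) e ->
     forall c, Cs e c <-> (D c /\ c < e)).

Definition last_below (D : K -> Prop) (g b : K) : Prop :=
  D b /\ b < g /\ forall c, D c -> c < g -> c <= b.

(** The second argument holds the earlier stages only, as [wf_build] requires. By [lift_local],
    ladders that agree below [g] share their maps. Along a ladder, [lift_path] permits finitely many
    errors at each step and [path_limit] permits none at limits, so errors never accumulate to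
    infinitely many. *)
Record stage_ok (g : K) (s : forall b, b < g -> stage) (r : stage) : Prop := {
  nodes_dom : forall x, nodes r x -> dom x = g;
  nodes_nonempty : exists x, nodes r x;
  nodes_restr : forall b h x, nodes r x -> nodes (s b h) (restr x b);
  nodes_extend : forall b h x, nodes (s b h) x -> exists y, nodes r y /\ pre x y;
  nodes_slim : card_le {x | nodes r x} (stock g);
  nodes_prolific : forall b h, (forall c, c < g <-> c <= b) -> forall x i,
    nodes (s b h) x -> i < b \/ finite_ord lt i -> exists y, nodes r y /\ pre x y /\ val y b = i;
  path_nodes : theta < g -> forall j, nodes r (path r j);
  path_inj : theta < g -> forall j j', path r j = path r j' -> j = j';
  path_ascent : forall b h, theta < b -> finite {j | ~ pre (path (s b h) j) (path r j)};
  path_limit : is_limit lt g -> forall d h, Cs g d -> theta < d ->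
    (forall c, Cs g c -> theta < c -> d <= c) ->
    forall j, path r j = lift r (Cs g) d (path (s d h) j);
  lift_id : forall D x, lift r D g x = x;
  lift_local : forall D D', (forall c, c < g -> (D c <-> D' c)) -> lift r D = lift r D';
  lift_nodes : forall D d h x, ladder g D -> D d -> nodes (s d h) x ->
    nodes r (lift r D d x) /\ pre x (lift r D d x);
  lift_comp : forall D d hd e he x, ladder g D -> D d -> D e -> d <= e -> nodes (s d hd) x ->
    pre (lift (s e he) D d x) (lift r D d x) /\
    lift r D e (lift (s e he) D d x) = lift r D d x;
  nodes_limit : is_limit lt g -> forall x, nodes r x ->
    exists d0, d0 < g /\ forall d, Cs g d -> d0 <= d -> x = lift r (Cs g) d (restr x d);
  lift_path : forall D b h, ladder g D -> last_below D g b -> theta < b ->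
    finite {j | lift r D b (path (s b h) j) <> path r j};
  (* The least index is sealed even on the path: this is what kills antichains, for which the
     vectors have length 1, and it spoils [lift_path] at one more [j] only. *)
  lift_seal : forall D b h, ladder g D -> last_below D g b ->
    forall t z d hd, Gz g t z -> D d -> d <= b ->
    (forall i, nodes (s d hd) (z i)) -> (forall i j, z i = z j -> i = j) ->
    (exists v, Ga g t v /\ forall i, (exists hv : dom (v i) < g, nodes (s _ hv) (v i)) /\
       pre (lift (s b h) D d (z i)) (v i)) ->
    exists v, Ga g t v /\ forall i,
      (forall c, ~ c < proj1_sig i) \/ (forall j, path (s b h) j <> lift (s b h) D d (z i)) ->
      sub (v i) (lift r D d (z i)) }.

Definition ok (s : K -> stage) (g : K) : Prop := stage_ok g (fun c _ => s c) (s g).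

Lemma ladder_mono g e D : ladder g D -> e <= g -> ladder e D.
Proof.
  intros [h1 h2] h. split; intros c k.
  - apply h1. eapply lt_le_tr; eauto.
  - apply h2. eapply le_tr; eauto.
Qed.

Lemma ladder_ext g D D' : (forall c, c < g -> (D c <-> D' c)) -> ladder g D -> ladder g D'.
Proof.
  intros E [h1 h2].
  assert (S : forall e, e <= g -> sup_is lt (fun b => D' b /\ b < e) e ->
    sup_is lt (fun b => D b /\ b < e) e).
  { intros e he [_ k]. split; [intros b [_ hb]; left; auto|].
    intros c hc. destruct (k c hc) as [b [[h3 h4] h5]]. exists b. repeat split; auto.
    apply E; auto. eapply lt_le_tr; eauto. }
  split.
  - intros e he nz sp. apply E; auto. apply h1; auto. apply S; auto. left; auto.
  - intros e he nz sp c. rewrite (h2 e he nz (S e he sp)).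
    split; intros [k l]; split; auto; apply E; auto; eapply lt_le_tr; eauto.
Qed.

(** Coherence gives the second clause at limits of [Cs g] below [g]; at [g] itself the two sets are
    the same. *)
Lemma ladder_Cs g : is_limit lt g -> ladder g (Cs g).
Proof.
  intros L. destruct (Cs_club g L) as [h1 [h2 h3]]. split; auto.
  intros e [he|he] nz sp c.
  - apply Cs_coherent. split; auto.
  - subst. split; [|tauto]. intros k. split; auto.
Qed.

(** If the supremum of [D] below [g] were less than [g], it would be a limit of [D] or attained; in
    both cases it would be the last element. *)
Lemma ladder_cofinal g D d : ladder g D -> D d -> d < g -> ~ (exists b, last_below D g b) ->
  forall c, c < g -> exists e, D e /\ e < g /\ c < e.
Proof.
  intros [A1 _] Dd dg N c cg.
  destruct (sup_exists (fun a => D a /\ a < g) g) as [s0 [S1 S2]].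
  { intros a [_ h]. left; auto. }
  assert (S3 : forall c, c < s0 -> exists a, D a /\ a < g /\ c < a).
  { intros a ha. apply NNPP. intros C. apply (lt_irr a). eapply lt_le_tr; [exact ha|].
    apply S2. intros x [h1 h2]. apply not_lt. intros h3. apply C. eauto. }
  assert (S4 : s0 <= g) by (apply S2; intros x [_ h]; left; auto).
  destruct S4 as [h|h]; [|subst; auto]. exfalso.
  assert (Ds : ~ D s0). { intros k. apply N. exists s0. repeat split; auto. }
  apply Ds. apply A1; auto.
  - exists d. destruct (S1 d); auto. subst. tauto.
  - split; [intros b [_ hb]; left; auto|]. intros a ha. destruct (S3 a ha) as [x [h1 [h2 h3]]].
    exists x. repeat split; auto. destruct (S1 x); auto. subst. tauto.
Qed.

Lemma ladder_eq_Cs g D : ladder g D -> (forall c, c < g -> exists e, D e /\ e < g /\ c < e) ->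
  nonzero lt g -> is_limit lt g /\ forall c, Cs g c <-> (D c /\ c < g).
Proof.
  intros [_ h] H nz. split.
  - split; auto. intros b hb. destruct (H b hb) as [e [_ [? ?]]]. eauto.
  - apply h; auto; [right; auto|]. split; [intros b [_ hb]; left; auto|].
    intros c hc. destruct (H c hc) as [e [? [? ?]]]. eauto.
Qed.

Lemma lift_nodes_le s b : ok s b -> forall D d x, d <= b -> ladder b D -> D d -> nodes (s d) x ->
  nodes (s b) (lift (s b) D d x) /\ pre x (lift (s b) D d x).
Proof.
  intros H D d x [h|<-] hD Dd hx.
  - apply (lift_nodes _ _ _ H D d h x); auto.
  - rewrite (lift_id _ _ _ H). split; auto. apply pre_refl.
Qed.

Lemma lift_comp_le s b : ok s b -> forall D d e x, d <= e -> e <= b -> ok s e -> ladder b D -> D d -> D e ->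
  nodes (s d) x -> pre (lift (s e) D d x) (lift (s b) D d x) /\
    lift (s b) D e (lift (s e) D d x) = lift (s b) D d x.
Proof.
  intros H D d e x h1 [h2|<-] He hD Dd De hx.
  - exact (lift_comp _ _ _ H D d (le_lt_tr _ _ _ h1 h2) e h2 x hD Dd De h1 hx).
  - rewrite (lift_id _ _ _ H). split; auto. apply pre_refl.
Qed.

(** * Unions of canonical extensions along a ladder *)

Section Step.
Variables (g : K) (s : K -> stage).
Hypothesis IH : forall b, b < g -> ok s b.

Lemma ladder_union_exists D d x : ladder g D -> (forall c, c < g -> exists e, D e /\ e < g /\ c < e) ->
  D d -> d < g -> nodes (s d) x ->
  exists y, dom y = g /\ forall e, D e -> e < g -> d <= e -> pre (lift (s e) D d x) y.
Proof.
  intros hD cof Dd dg hx.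
  destruct (chain_union (fun e => D e /\ e < g /\ d <= e) g (fun e => lift (s e) D d x)) as [y [h1 h2]].
  - intros c hc. assert (E : exists m, m < g /\ d <= m /\ c <= m).
    { destruct (le_total c d) as [h|h]; [exists d | exists c]; repeat split; auto; right; auto. }
    destruct E as [m [h1 [h2 h3]]].
    destruct (cof m h1) as [e [k1 [k2 k3]]]. exists e. repeat split; auto.
    + left. eapply le_lt_tr; eauto.
    + eapply le_lt_tr; eauto.
  - tauto.
  - intros e [De [eg de]]. apply (nodes_dom _ _ _ (IH e eg)).
    apply lift_nodes_le; auto. apply (ladder_mono g); auto. left; auto.
  - intros e e' [De [eg de]] [De' [eg' de']] h.
    apply lift_comp_le; auto. apply (ladder_mono g); auto. left; auto.
  - exists y. split; auto.
Qed.

Definition ladder_union (D : K -> Prop) (d : K) (x : node) : node :=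
  epsilon (inhabits x) (fun y => dom y = g /\ forall e, D e -> e < g -> d <= e -> pre (lift (s e) D d x) y).

Lemma ladder_union_spec D d x : ladder g D -> (forall c, c < g -> exists e, D e /\ e < g /\ c < e) ->
  D d -> d < g -> nodes (s d) x ->
  dom (ladder_union D d x) = g /\
  forall e, D e -> e < g -> d <= e -> pre (lift (s e) D d x) (ladder_union D d x).
Proof. intros. unfold ladder_union. apply epsilon_spec. apply ladder_union_exists; auto. Qed.

(** By [lift_comp] the branches started at [d] and at [e] have the same nodes at cofinally many
    levels. *)
Lemma ladder_union_comp D d e x : ladder g D -> (forall c, c < g -> exists e, D e /\ e < g /\ c < e) ->
  D d -> D e -> d <= e -> e < g -> nodes (s d) x ->
  ladder_union D e (lift (s e) D d x) = ladder_union D d x.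
Proof.
  intros hD cof Dd De de eg hx. assert (dg : d < g) by (eapply le_lt_tr; eauto).
  destruct (ladder_union_spec D d x) as [h1 h2]; auto.
  destruct (lift_nodes_le s e (IH e eg) D d x) as [h3 h4]; auto.
  { apply (ladder_mono g); auto. left; auto. }
  destruct (ladder_union_spec D e (lift (s e) D d x)) as [h5 h6]; auto.
  apply (node_eq_of_cofinal g); auto. intros c hc.
  assert (E : exists m, m < g /\ e <= m /\ c <= m).
  { destruct (le_total c e) as [h|h]; [exists e | exists c]; repeat split; auto; right; auto. }
  destruct E as [m [q1 [q2 q3]]].
  destruct (cof m q1) as [k [k1 [k2 k3]]].
  assert (ek : e <= k) by (left; eapply le_lt_tr; eauto).
  assert (dk : d <= k) by (eapply le_tr; eauto).
  assert (hk : ladder k D) by (apply (ladder_mono g); auto; left; auto).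
  exists (lift (s k) D d x). split; [|split; auto].
  - destruct (lift_nodes_le s k (IH k k2) D d x) as [n _]; auto.
    rewrite (nodes_dom _ _ _ (IH k k2) _ n). eapply le_lt_tr; eauto.
  - destruct (lift_comp_le s k (IH k k2) D d e x) as [_ <-]; auto.
Qed.

(** * The extension maps into a new level *)

Section Lift.
Variables (Tg : node -> Prop) (Fg : seg theta -> node).
Hypothesis Tg_dom : forall x, Tg x -> dom x = g.
Hypothesis Tg_extend : forall b, b < g -> forall x, nodes (s b) x -> exists y, Tg y /\ pre x y.
Hypothesis Fg_nodes : theta < g -> forall j, Tg (Fg j).
Hypothesis Fg_ascent : forall b, b < g -> theta < b -> finite {j | ~ pre (path (s b) j) (Fg j)}.
Hypothesis Tg_union : is_limit lt g -> forall d x, Cs g d -> nodes (s d) x -> Tg (ladder_union (Cs g) d x).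

(* [R x v] asks the step from level [b] to level [g] to send [x] above [v]; elsewhere the
   step follows the path. *)
Lemma step_map b (R : node -> node -> Prop) : b < g ->
  (forall x v, R x v -> pre x v /\ dom v < g /\ nodes (s (dom v)) v) ->
  (forall x v v', R x v -> R x v' -> v = v') ->
  (forall j j' v v', R (path (s b) j) v -> R (path (s b) j') v' -> path (s b) j = path (s b) j') ->
  exists E : node -> node,
    (forall x, nodes (s b) x -> Tg (E x) /\ pre x (E x)) /\
    (theta < b -> finite {j | E (path (s b) j) <> Fg j}) /\
    (forall x v, nodes (s b) x -> R x v -> pre v (E x)).
Proof.
  intros bg R1 R2 R3.
  destruct (choice_on _ _ (existT _ g (fun _ => g) : node) (nodes (s b)) (fun x e => Tg e /\ pre x e /\
    (forall v, R x v -> pre v e) /\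
    (theta < b -> forall j, x = path (s b) j -> pre x (Fg j) -> (forall v, ~ R x v) -> e = Fg j)))
    as [E HE].
  - intros x hx. destruct (classic (exists v, R x v)) as [[v hv]|N].
    + destruct (R1 x v hv) as [h1 [h2 h3]]. destruct (Tg_extend _ h2 v h3) as [e [h4 h5]].
      exists e. split; [auto|split; [eapply pre_tr; eauto|split]].
      * intros v' hv'. rewrite (R2 x v' v); auto.
      * intros _ j _ _ C. destruct (C v hv).
    + destruct (classic (theta < b /\ exists j, x = path (s b) j /\ pre x (Fg j)))
        as [[tb [j [h1 h2]]]|N'].
      * exists (Fg j). split; [apply Fg_nodes; eapply lt_tr; eauto|split; [auto|split]].
        -- intros v hv. destruct N; eauto.
        -- intros _ j' h3 _ _. f_equal. apply (path_inj _ _ _ (IH b bg)); auto. congruence.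
      * destruct (Tg_extend b bg x hx) as [e [h4 h5]]. exists e. split; [auto|split; [auto|split]].
        -- intros v hv. destruct N; eauto.
        -- intros tb j h1 h2 _. destruct N'; eauto.
  - exists E. split; [|split].
    + intros x hx. specialize (HE x hx). tauto.
    (* The path is left only where it does not extend to [Fg], finitely often by [Fg_ascent], or
       where [R] redirects it, at most once by [R3]. *)
    + intros tb. apply (finite_subset _ _ (fun j => ~ pre (path (s b) j) (Fg j) \/ exists v, R (path (s b) j) v)).
      * intros j hj. apply NNPP. intros C. apply hj.
        apply (proj2 (proj2 (proj2 (HE _ (path_nodes _ _ _ (IH b bg) tb j))))) with (j := j); auto.
        -- apply NNPP. tauto.
        -- intros v hv. apply C. eauto.
      * apply finite_or; [apply Fg_ascent; auto|].
        apply finite_at_most_one. intros j j' [v hv] [v' hv'].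
        apply (path_inj _ _ _ (IH b bg)); eauto.
    + intros x v hx hv. apply HE; auto.
Qed.

(* The requirements on [lift r D], for a single ladder [D]. *)
Definition lift_ok (D : K -> Prop) (q : K -> node -> node) : Prop :=
  (forall d x, d < g -> D d -> nodes (s d) x -> Tg (q d x) /\ pre x (q d x)) /\
  (forall d e x, d < g -> e < g -> D d -> D e -> d <= e -> nodes (s d) x ->
    pre (lift (s e) D d x) (q d x) /\ q e (lift (s e) D d x) = q d x) /\
  (forall b, last_below D g b -> theta < b -> finite {j | q b (path (s b) j) <> Fg j}) /\
  (forall b, last_below D g b ->
    forall t z d, Gz g t z -> D d -> d <= b ->
    (forall i, nodes (s d) (z i)) -> (forall i j, z i = z j -> i = j) ->
    (exists v, Ga g t v /\ forall i, (dom (v i) < g /\ nodes (s (dom (v i))) (v i)) /\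
       pre (lift (s b) D d (z i)) (v i)) ->
    exists v, Ga g t v /\ forall i,
      (forall c, ~ c < proj1_sig i) \/ (forall j, path (s b) j <> lift (s b) D d (z i)) ->
      sub (v i) (q d (z i))) /\
  (is_limit lt g -> (forall c, Cs g c <-> D c) -> forall d x, Cs g d -> nodes (s d) x ->
     q d x = ladder_union (Cs g) d x).

Lemma last_below_unique D b b' : last_below D g b -> last_below D g b' -> b = b'.
Proof. intros [? [? ?]] [? [? ?]]. apply le_antisym; auto. Qed.

(** All maps into level [g] factor through level [b]: one step map [E] is composed with the lifts to
    [b]. As [Gz] is functional, [E] has at most one guessed vector to serve. *)
Lemma lift_ok_successor D b : ladder g D -> last_below D g b -> exists q, lift_ok D q.
Proof.
  intros hD hb. pose proof hb as [Db [bg bmax]].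
  assert (hDb : ladder b D) by (apply (ladder_mono g); auto; left; auto).
  pose (seal_task := fun t (z : seg t -> node) d v => Gz g t z /\ D d /\ d <= b /\
    (forall i, nodes (s d) (z i)) /\ (forall i j, z i = z j -> i = j) /\
    Ga g t v /\ forall i, (dom (v i) < g /\ nodes (s (dom (v i))) (v i)) /\
       pre (lift (s b) D d (z i)) (v i)).
  assert (Linj : forall d x y, D d -> d <= b -> nodes (s d) x -> nodes (s d) y ->
    lift (s b) D d x = lift (s b) D d y -> x = y).
  { intros d x y Dd db hx hy E.
    assert (dg : d < g) by (eapply le_lt_tr; eauto).
    destruct (lift_nodes_le s b (IH b bg) D d x) as [_ px]; auto.
    destruct (lift_nodes_le s b (IH b bg) D d y) as [_ py]; auto.
    rewrite E in px. pose proof (nodes_dom _ _ _ (IH d dg) x hx). pose proof (nodes_dom _ _ _ (IH d dg) y hy).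
    apply pre_eq; [|congruence]. eapply pre_common; eauto. right; congruence. }
  assert (X : exists E : node -> node,
    (forall x, nodes (s b) x -> Tg (E x) /\ pre x (E x)) /\
    (theta < b -> finite {j | E (path (s b) j) <> Fg j}) /\
    (forall t z d v, seal_task t z d v -> exists v, Ga g t v /\ forall i,
      (forall c, ~ c < proj1_sig i) \/ (forall j, path (s b) j <> lift (s b) D d (z i)) ->
      sub (v i) (E (lift (s b) D d (z i))))).
  { destruct (classic (exists t z d v, seal_task t z d v)) as [[t [z [d [v Q]]]]|N].
    - pose proof Q as [Q1 [Q2 [Q3 [Q4 [Q5 [Q6 Q7]]]]]].
      (* Apart from the least index, only images outside the path are redirected. Hence at most one
         path value is disturbed, which the case analysis on two indices confirms. *)
      destruct (step_map b (fun x w => exists i, x = lift (s b) D d (z i) /\ w = v i /\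
        ((forall c, ~ c < proj1_sig i) \/ (forall j, path (s b) j <> lift (s b) D d (z i)))))
        as [E [E1 [E2 E3]]]; auto.
      + intros x w [i [-> [-> _]]]. destruct (Q7 i). tauto.
      + intros x w w' [i [hx [-> _]]] [i' [hx' [-> _]]]. f_equal.
        apply Q5, (Linj d); auto. congruence.
      + intros j j' w w' [i [h1 [_ [h2|h2]]]] [i' [h1' [_ [h2'|h2']]]].
        * rewrite h1, h1'. do 2 f_equal. apply sig_eq. apply le_antisym; apply not_lt; auto.
        * destruct (h2' _ h1').
        * destruct (h2 _ h1).
        * destruct (h2 _ h1).
      + exists E. split; [auto|split; [auto|]].
        (* Any other task concerns the same vector and hence the same level, so the [v] used to
           build [E] answers it too. *)
        intros t' z' d' v' [R1 [R2 [R3 [R4 [_ [R6 _]]]]]].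
        pose proof (Gz_functional _ _ _ _ _ Q1 R1) as EQ.
        assert (t = t') by (inversion EQ; auto). subst t'.
        apply inj_pairT2 in EQ. subst z'.
        exists v. split; auto. intros i hi.
        assert (dd : d' = d).
        { rewrite <- (nodes_dom _ _ _ (IH d (le_lt_tr _ _ _ Q3 bg)) _ (Q4 i)).
          symmetry. apply (nodes_dom _ _ _ (IH d' (le_lt_tr _ _ _ R3 bg)) _ (R4 i)). }
        subst d'. destruct (lift_nodes_le s b (IH b bg) D d (z i)) as [n _]; auto.
        apply sub_pre. split.
        * apply E3; eauto.
        * rewrite (Tg_dom _ (proj1 (E1 _ n))). apply Q7.
    - destruct (step_map b (fun _ _ => False)) as [E [E1 [E2 E3]]]; try tauto.
      exists E. split; [auto|split; [auto|]].
      intros t z d v Q. destruct N. exists t, z, d, v. auto. }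
  destruct X as [E [E1 [E2 E3]]].
  exists (fun d x => E (lift (s b) D d x)). split; [|split; [|split; [|split]]].
  - intros d x dg Dd hx. destruct (lift_nodes_le s b (IH b bg) D d x) as [h1 h2]; auto.
    destruct (E1 _ h1) as [h3 h4]. split; auto. eapply pre_tr; eauto.
  - intros d e x dg eg Dd De de hx.
    destruct (lift_comp_le s b (IH b bg) D d e x) as [h1 h2]; auto.
    destruct (lift_nodes_le s b (IH b bg) D d x) as [h3 _]; auto.
    split.
    + eapply pre_tr; [exact h1|]. apply E1; auto.
    + f_equal. auto.
  - intros b' hb'. rewrite (last_below_unique D b' b hb' hb). intros tb.
    eapply finite_subset; [|exact (E2 tb)]. intros j. cbv beta.
    rewrite (lift_id _ _ _ (IH b bg)). auto.
  - intros b' hb'. rewrite (last_below_unique D b' b hb' hb).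
    intros t z d Q1 Q2 Q3 Q4 Q5 [v [Q6 Q7]]. apply (E3 t z d v). repeat split; auto; apply Q7.
  (* The union clause is vacuous: [Cs g] is cofinal in the limit [g], while [D] has a last element
     below [g]. *)
  - intros L HC. exfalso. destruct (Cs_club g L) as [h1 [h2 h3]].
    destruct L as [_ L]. destruct (L b bg) as [c [bc cg]]. destruct (h2 c cg) as [c' [k1 k2]].
    apply (lt_irr b). eapply lt_le_tr; [exact bc|]. eapply le_tr; [exact k2|].
    apply bmax; auto. apply HC; auto.
Qed.

(** Without a last element, [D] is either cofinal in [g], hence equal to [Cs g], and unions of
    branches serve; or it is empty and every clause is vacuous. *)
Lemma lift_ok_exists D : ladder g D -> (forall c, D c -> c < g) -> exists q, lift_ok D q.
Proof.
  intros hD Dg. destruct (classic (exists b, last_below D g b)) as [[b hb]|N].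
  { apply (lift_ok_successor D b); auto. }
  destruct (classic (exists d, D d)) as [[d0 Dd0]|N'].
  - assert (cof := ladder_cofinal g D d0 hD Dd0 (Dg _ Dd0) N).
    assert (nz : nonzero lt g) by (exists d0; auto).
    destruct (ladder_eq_Cs g D hD cof nz) as [L EQ].
    assert (D = Cs g).
    { apply functional_extensionality; intros c. apply propositional_extensionality.
      rewrite EQ. split; [auto|tauto]. }
    subst D. exists (ladder_union (Cs g)). split; [|split; [|split; [|split]]].
    + intros d x dg Dd hx. split; auto.
      destruct (ladder_union_spec (Cs g) d x) as [_ h]; auto.
      eapply pre_tr; [|apply (h d); auto; right; auto].
      rewrite (lift_id _ _ _ (IH d dg)). apply pre_refl.
    + intros d e x dg eg Dd De de hx. split.
      * apply ladder_union_spec; auto.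
      * apply ladder_union_comp; auto.
    + intros b hb. destruct N; eauto.
    + intros b hb. destruct N; eauto.
    + auto.
  - exists (fun _ x => x). split; [|split; [|split; [|split]]].
    + intros d x _ Dd. destruct N'; eauto.
    + intros d e x _ _ Dd. destruct N'; eauto.
    + intros b hb. destruct N; eauto.
    + intros b hb. destruct N; eauto.
    + intros _ HC d x Cd. destruct N'. exists d. apply HC; auto.
Qed.

Lemma lift_exists : exists P : (K -> Prop) -> K -> node -> node,
  (forall D x, P D g x = x) /\
  (forall D D', (forall c, c < g -> (D c <-> D' c)) -> P D = P D') /\
  (forall D, ladder g D -> lift_ok D (P D)).
Proof.
  destruct (choice_on _ _ (fun _ x => x) (fun D => ladder g D /\ forall c, D c -> c < g) lift_ok)
    as [p Hp].
  { intros D [h1 h2]. apply lift_ok_exists; auto. }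
  (* Cutting ladders at [g] before the maps are chosen yields locality. *)
  pose (cut := fun (D : K -> Prop) c => D c /\ c < g).
  exists (fun D d x => if dec (d = g) then x else p (cut D) d x). split; [|split].
  - intros D x. destruct (dec (g = g)); tauto.
  - intros D D' E. assert (Q : cut D = cut D').
    { apply functional_extensionality; intros c. apply propositional_extensionality.
      unfold cut. specialize (E c). tauto. }
    rewrite Q. auto.
  - intros D hD.
    assert (EQ : forall c, c < g -> (cut D c <-> D c)) by (unfold cut; tauto).
    assert (hc : ladder g (cut D)) by (eapply ladder_ext; [|exact hD]; intros c h; symmetry; auto).
    assert (NE : forall d (x y : node), d < g -> (if dec (d = g) then x else y) = y).
    { intros d x y h. destruct (dec (d = g)); auto. subst. destruct (lt_irr g); auto. }
    assert (LB : forall b, last_below D g b -> last_below (cut D) g b).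
    { intros b [h1 [h2 h3]]. unfold cut. repeat split; auto. intros c [h4 _]; auto. }
    assert (LL : forall e, e < g -> lift (s e) D = lift (s e) (cut D)).
    { intros e he. apply (lift_local _ _ _ (IH e he)). intros c hce. symmetry. apply EQ.
      eapply lt_tr; eauto. }
    destruct (Hp (cut D)) as [H1 [H2 [H3 [H4 H5]]]]. { split; [auto|unfold cut; tauto]. }
    split; [|split; [|split; [|split]]].
    + intros d x dg Dd hx. rewrite NE; auto. apply H1; auto. apply EQ; auto.
    + intros d e x dg eg Dd De de hx. rewrite !NE, LL; auto. apply H2; auto; apply EQ; auto.
    + intros b hb tb. eapply finite_subset; [|apply (H3 b); auto]. intros j. cbv beta.
      rewrite NE; auto. apply hb.
    + intros b hb t z d Q1 Q2 Q3 Q4 Q5 Q6. assert (bg : b < g) by apply hb.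
      assert (dg : d < g) by (eapply le_lt_tr; eauto).
      rewrite LL in * |- *; auto.
      destruct (H4 b (LB b hb) t z d) as [v [h1 h2]]; auto. { apply EQ; auto. }
      exists v. split; auto. intros i. rewrite NE; auto.
    + intros L HC d x Cd hx. assert (dg : d < g) by (apply (Cs_club g L); auto).
      rewrite NE; auto. apply H5; auto. intros c. rewrite HC. unfold cut.
      split; [|tauto]. intros h. split; auto. apply (Cs_club g L). apply HC; auto.
Qed.

(** Once the level and the path are fixed, [lift_exists] supplies the maps; the limit clauses may
    then be checked for [ladder_union] in place of [lift]. *)
Lemma stage_ok_intro :
  (exists x, Tg x) ->
  (forall b x, b < g -> Tg x -> nodes (s b) (restr x b)) ->
  card_le {x | Tg x} (stock g) ->
  (forall b, b < g -> (forall c, c < g <-> c <= b) -> forall x i,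
    nodes (s b) x -> i < b \/ finite_ord lt i -> exists y, Tg y /\ pre x y /\ val y b = i) ->
  (theta < g -> forall j j', Fg j = Fg j' -> j = j') ->
  (is_limit lt g -> forall d, Cs g d -> theta < d ->
    (forall c, Cs g c -> theta < c -> d <= c) ->
    forall j, Fg j = ladder_union (Cs g) d (path (s d) j)) ->
  (is_limit lt g -> forall x, Tg x -> exists d0, d0 < g /\ forall d, Cs g d -> d0 <= d ->
     x = ladder_union (Cs g) d (restr x d)) ->
  exists r, stage_ok g (fun c _ => s c) r.
Proof.
  intros A1 A2 A3 A4 A5 A6 A7. destruct lift_exists as [P [P1 [P2 P3]]].
  assert (PU : is_limit lt g -> forall d x, Cs g d -> nodes (s d) x ->
     P (Cs g) d x = ladder_union (Cs g) d x).
  { intros L d x. apply (P3 (Cs g)); auto using ladder_Cs. tauto. }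
  exists (Stage Tg Fg P). constructor; simpl; auto.
  - intros L d h Cd td dmin j. rewrite PU; auto.
    apply (path_nodes _ _ _ (IH d h)); auto.
  - intros D d h x hD. apply P3; auto.
  - intros D d hd e he x hD. apply P3; auto.
  - intros L x hx. destruct (A7 L x hx) as [d0 [h1 h2]]. exists d0. split; auto.
    intros d Cd hd. rewrite PU; auto. apply A2; auto. apply (Cs_club g L); auto.
  - intros D b h hD hb. apply P3; auto.
  - intros D b h hD hb t z d hd Q1 Q2 Q3 Q4 Q5 [v [Q6 Q7]].
    apply (proj1 (proj2 (proj2 (proj2 (P3 D hD))))); auto.
    exists v. split; auto. intros i. destruct (Q7 i) as [[hv k] l]. auto.
Qed.
End Lift.

(** * Construction of the zero, successor and limit levels *)

Lemma stage_exists_zero : (forall b, ~ b < g) -> exists r, stage_ok g (fun c _ => s c) r.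
Proof.
  intros Z. pose (x0 := mk g (fun c => c)).
  assert (ND : is_limit lt g -> False). { intros [[b hb] _]. exact (Z b hb). }
  apply (stage_ok_intro (fun x => dom x = g) (fun _ => x0)).
  - auto.
  - intros b h. destruct (Z b h).
  - auto.
  - intros b h. destruct (Z b h).
  - tauto.
  - exists x0. auto.
  - intros b x h. destruct (Z b h).
  - eapply card_le_trans; [|apply nat_le_stock]. exists (fun _ => 0). intros [x hx] [y hy] _.
    apply sig_eq. simpl. apply node_ext; [congruence|]. intros c hc. rewrite hx in hc. destruct (Z c hc).
  - intros b h. destruct (Z b h).
  - intros h. destruct (Z _ h).
  - tauto.
  - tauto.
Qed.

Lemma stage_exists_successor b : (forall c, c < g <-> c <= b) ->
  exists r, stage_ok g (fun c _ => s c) r.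
Proof.
  intros Sb. assert (bg : b < g) by (apply Sb; right; auto).
  assert (IHb := IH b bg).
  assert (ND : is_limit lt g -> False).
  { intros [_ L]. destruct (L b bg) as [c [h1 h2]]. apply Sb in h2.
    apply (lt_irr b). eapply lt_le_tr; eauto. }
  destruct (nodes_nonempty _ _ _ IHb) as [u hu].
  destruct (least (fun _ => True)) as [o [_ Ho]]; [exists g; auto|].
  assert (Fo : finite_ord lt o).
  { exists 0. exists (fun x : seg o => match lt_irr o (le_lt_tr _ _ _ (Ho _ I) (proj2_sig x)) with end).
    intros x. destruct (lt_irr o (le_lt_tr _ _ _ (Ho _ I) (proj2_sig x))). }
  pose (snoc := fun x i => mk g (fun c => if dec (c < b) then val x c else i)).
  assert (snoc_pre : forall x i, nodes (s b) x -> pre x (snoc x i)).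
  { intros x i hx. apply (nodes_dom _ _ _ IHb) in hx. split.
    - left. rewrite hx. auto.
    - rewrite hx. intros c hc. unfold snoc. rewrite val_mk; [|eapply lt_tr; eauto].
      destruct (dec (c < b)); tauto. }
  assert (snoc_last : forall x i, val (snoc x i) b = i).
  { intros x i. unfold snoc. rewrite val_mk; auto. destruct (dec (b < b)) as [h|]; auto.
    destruct (lt_irr b h). }
  assert (snoc_inj : forall x i x' i', nodes (s b) x -> nodes (s b) x' -> snoc x i = snoc x' i' ->
    x = x' /\ i = i').
  { intros x i x' i' hx hx' E. split.
    - pose proof (snoc_pre x i hx) as h. rewrite E in h.
      assert (dom x = dom x') by (rewrite (nodes_dom _ _ _ IHb _ hx), (nodes_dom _ _ _ IHb _ hx'); auto).
      apply pre_eq; auto. eapply pre_common; eauto. right; auto.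
    - rewrite <- (snoc_last x i), E. apply snoc_last. }
  pose (Tg := fun y => exists x i, nodes (s b) x /\ (i < b \/ finite_ord lt i) /\ y = snoc x i).
  (* At [b = theta] the path starts, with [theta] many distinct successors of one node [u];
     prolificness allows their last entries. For smaller [b] the value is junk. *)
  pose (Fg := fun j : seg theta => if dec (theta < b) then snoc (path (s b) j) o else snoc u (proj1_sig j)).
  assert (extend : forall c x, c <= b -> nodes (s c) x -> exists y, nodes (s b) y /\ pre x y).
  { intros c x [h|<-] hx.
    - apply (nodes_extend _ _ _ IHb c h); auto.
    - exists x. split; auto. apply pre_refl. }
  apply (stage_ok_intro Tg Fg); try tauto.
  - intros y [x [i [_ [_ ->]]]]. reflexivity.
  - intros c hc x hx. apply Sb in hc. destruct (extend c x hc hx) as [y [h1 h2]].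
    exists (snoc y o). split; [exists y, o; auto|]. eapply pre_tr; eauto.
  - intros h j. unfold Fg. destruct (dec (theta < b)) as [k|k].
    + exists (path (s b) j), o. split; [apply (path_nodes _ _ _ IHb); auto|auto].
    + exists u, (proj1_sig j). split; [auto|]. split; [|auto]. left.
      apply Sb in h. destruct h as [h|<-]; [tauto|]. exact (proj2_sig j).
  - intros c hc tc. apply Sb in hc. unfold Fg.
    destruct (dec (theta < b)) as [k|k]; [|destruct k; eapply lt_le_tr; eauto].
    assert (N : forall j, nodes (s b) (path (s b) j)) by (apply (path_nodes _ _ _ IHb); auto).
    destruct hc as [hc| ->].
    + eapply finite_subset; [|apply (path_ascent _ _ _ IHb c hc tc)]. intros j. cbv beta.
      intros h k'. apply h. eapply pre_tr; [exact k'|]. auto.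
    + apply finite_at_most_one. intros j j' h. destruct h. auto.
  - exists (snoc u o). exists u, o. auto.
  - intros c y hc [x [i [hx [_ ->]]]]. apply Sb in hc.
    rewrite (restr_of_pre x); auto. 2: rewrite (nodes_dom _ _ _ IHb _ hx); auto.
    destruct hc as [hc| ->]; [apply (nodes_restr _ _ _ IHb); auto|].
    rewrite (pre_restr_eq x); auto. { apply pre_refl. } apply (nodes_dom _ _ _ IHb _ hx).
  (* A new node is a node of level [b] together with its last entry. *)
  - apply (card_le_trans _ ({x | nodes (s b) x} * {i | i < b \/ finite_ord lt i})).
    { apply (card_le_rel _ _ (fun y p => proj1_sig y = snoc (proj1_sig (fst p)) (proj1_sig (snd p)))).
      - intros [y [x [i [h1 [h2 h3]]]]]. exists (exist _ x h1, exist _ i h2). auto.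
      - intros y y' p E E'. apply sig_eq. congruence. }
    apply (card_le_trans _ (stock b * stock b)).
    2: { eapply card_le_trans; [apply stock_square|]. apply stock_mono. left; auto. }
    apply card_le_prod; [apply (nodes_slim _ _ _ IHb)|].
    destruct finite_ords_countable as [f Hf].
    apply (card_le_rel _ _ (fun i v => match v with
      | inl c => proj1_sig c = proj1_sig i
      | inr n => exists h : finite_ord lt (proj1_sig i), f (exist _ _ h) = n end)).
    + intros [i [h|h]].
      * exists (inl (exist _ i h)). auto.
      * exists (inr (f (exist _ i h))). simpl. eauto.
    + intros [i hi] [i' hi'] [c|n]; simpl.
      * intros E E'. apply sig_eq. simpl. congruence.
      * intros [h <-] [h' E]. apply Hf in E. inversion E. apply sig_eq. auto.
  - intros c hc Sc x i hx hi.
    assert (c = b) by (apply le_antisym; [apply Sb; auto | apply Sc; auto]). subst c.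
    exists (snoc x i). split; [exists x, i; auto|]. auto.
  - intros h j j'. unfold Fg. destruct (dec (theta < b)) as [k|k]; intros E.
    + apply snoc_inj in E; try (apply (path_nodes _ _ _ IHb); auto). apply (path_inj _ _ _ IHb); tauto.
    + apply snoc_inj in E; auto. apply sig_eq. tauto.
Qed.

Lemma stage_exists_limit : is_limit lt g -> exists r, stage_ok g (fun c _ => s c) r.
Proof.
  intros L. pose proof (ladder_Cs g L) as hC. destruct (Cs_club g L) as [Cg [Ccof _]].
  assert (cof : forall c, c < g -> exists e, Cs g e /\ e < g /\ c < e).
  { intros c hc. destruct (proj2 L c hc) as [c' [h1 h2]]. destruct (Ccof c' h2) as [e [h3 h4]].
    exists e. repeat split; auto. eapply lt_le_tr; eauto. }
  assert (cof2 : forall c d, c < g -> d < g -> exists e, Cs g e /\ e < g /\ c < e /\ d < e).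
  { intros c d hc hd. destruct (le_total c d) as [h|h].
    - destruct (cof d hd) as [e [? [? ?]]]. exists e. repeat split; auto. eapply le_lt_tr; eauto.
    - destruct (cof c hc) as [e [? [? ?]]]. exists e. repeat split; auto. eapply le_lt_tr; eauto. }
  assert (hL : forall e, e < g -> ladder e (Cs g)) by (intros; apply (ladder_mono g); auto; left; auto).
  assert (U := fun d x Cd => ladder_union_spec (Cs g) d x hC cof Cd (Cg d Cd)).
  assert (Upre : forall d x, Cs g d -> nodes (s d) x -> pre x (ladder_union (Cs g) d x)).
  { intros d x Cd hx. destruct (U d x Cd hx) as [_ h]. eapply pre_tr; [|apply (h d); auto; right; auto].
    rewrite (lift_id _ _ _ (IH d (Cg d Cd))). apply pre_refl. }
  (* The path at [g] is extended from [d0], the first point of [Cs g] above [theta]; if there is no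
     room above [theta], [g] is a dummy. *)
  assert (X : exists d0, theta < g -> Cs g d0 /\ theta < d0 /\ forall c, Cs g c -> theta < c -> d0 <= c).
  { destruct (classic (theta < g)) as [h|h]; [|exists g; tauto].
    destruct (cof theta h) as [e [h1 [_ h2]]].
    destruct (least (fun e => Cs g e /\ theta < e)) as [d0 [[k1 k2] k3]]; [eauto|].
    exists d0. repeat split; auto. }
  destruct X as [d0 Hd0].
  pose (Tg := fun y => exists d x, Cs g d /\ nodes (s d) x /\ y = ladder_union (Cs g) d x).
  pose (Fg := fun j => ladder_union (Cs g) d0 (path (s d0) j)).
  assert (N0 : theta < g -> forall j, nodes (s d0) (path (s d0) j)).
  { intros h. destruct (Hd0 h) as [h1 [h2 _]]. apply (path_nodes _ _ _ (IH d0 (Cg d0 h1))); auto. }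
  (* Induction along [Cs g]: a successor point adds finitely many exceptions to those of its
     predecessor, and at a limit point [path_limit] leaves no exception, since by coherence [Cs e]
     also starts from [d0]. *)
  assert (follow : theta < g -> forall e, Cs g e -> d0 <= e ->
    finite {j | lift (s e) (Cs g) d0 (path (s d0) j) <> path (s e) j}).
  { intros tg. destruct (Hd0 tg) as [C0 [t0 min0]].
    intros e. induction e as [e IHe] using (well_founded_induction lt_wf). intros Ce [h|<-].
    2:{ apply finite_at_most_one. intros j j' k. destruct k. apply (lift_id _ _ _ (IH d0 (Cg _ C0))). }
    assert (eg := Cg e Ce).
    destruct (classic (exists b, last_below (Cs g) e b)) as [[b hb]|N].
    - pose proof hb as [Cb [be bmax]]. assert (d0b : d0 <= b) by auto.
      assert (bg : b < g) by auto.
      eapply finite_subset; [|apply finite_or; [exact (IHe b be Cb d0b)|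
        apply (lift_path _ _ _ (IH e eg) (Cs g) b be (hL e eg) hb); eapply lt_le_tr; eauto]].
      intros j hj. apply NNPP. intros C. apply hj.
      destruct (lift_comp_le s e (IH e eg) (Cs g) d0 b (path (s d0) j)) as [_ <-]; auto. { left; auto. }
      assert (E1 : lift (s b) (Cs g) d0 (path (s d0) j) = path (s b) j) by (apply NNPP; tauto).
      rewrite E1. apply NNPP. tauto.
    - apply finite_at_most_one. intros j j' k. destruct k.
      assert (cofe := ladder_cofinal e (Cs g) d0 (hL e eg) C0 h N).
      destruct (ladder_eq_Cs e (Cs g) (hL e eg) cofe) as [Le EQ]. { exists d0; auto. }
      rewrite (path_limit _ _ _ (IH e eg) Le d0 h).
      + rewrite (lift_local _ _ _ (IH e eg) (Cs g) (Cs e)); auto. intros c hc. rewrite EQ. tauto.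
      + apply EQ; auto.
      + auto.
      + intros c Cc. apply min0. apply EQ; auto. }
  assert (Udown : forall d x e, Cs g d -> nodes (s d) x -> Cs g e -> d <= e ->
    nodes (s e) (lift (s e) (Cs g) d x) /\ restr (ladder_union (Cs g) d x) e = lift (s e) (Cs g) d x).
  { intros d x e Cd hx Ce de. assert (eg := Cg e Ce).
    destruct (lift_nodes_le s e (IH e eg) (Cs g) d x) as [h _]; auto.
    split; auto. apply pre_restr_eq; [|apply (nodes_dom _ _ _ (IH e eg)); auto]. apply U; auto. }
  apply (stage_ok_intro Tg Fg).
  - intros y [d [x [Cd [hx ->]]]]. apply U; auto.
  - intros b hb x hx. destruct (cof b hb) as [e [Ce [eg be]]].
    destruct (nodes_extend _ _ _ (IH e eg) b be x hx) as [y [h1 h2]].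
    exists (ladder_union (Cs g) e y). split; [exists e, y; auto|]. eapply pre_tr; [exact h2|]. auto.
  - intros h j. exists d0, (path (s d0) j). split; [apply Hd0; auto|]. auto.
  - intros b bg tb. assert (tg : theta < g) by (eapply lt_tr; eauto).
    destruct (Hd0 tg) as [C0 [t0 min0]].
    (* The path at [b] is compared with the path at a point [e] of [Cs g], and that with the new
       path through [follow]. *)
    destruct (cof2 b d0 bg (Cg _ C0)) as [e [Ce [eg [be d0e]]]].
    eapply finite_subset; [|apply finite_or; [apply (path_ascent _ _ _ (IH e eg) b be tb)|
      apply (follow tg e Ce); left; auto]].
    intros j hj. apply NNPP. intros C. apply hj. apply not_or_and in C as [C1 C2].
    apply NNPP in C1. apply NNPP in C2. eapply pre_tr; [exact C1|]. rewrite <- C2.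
    apply U; auto. left; auto.
  - intros _ d x Cd hx. exists d, x. auto.
  - destruct L as [[b hb] _]. destruct (cof b hb) as [e [Ce [eg _]]].
    destruct (nodes_nonempty _ _ _ (IH e eg)) as [x hx]. exists (ladder_union (Cs g) e x), e, x. auto.
  - intros b y bg [d [x [Cd [hx ->]]]].
    destruct (cof2 b d bg (Cg d Cd)) as [e [Ce [eg [be de]]]].
    destruct (Udown d x e Cd hx Ce (or_introl de)) as [h1 h2].
    rewrite (restr_of_pre (lift (s e) (Cs g) d x)).
    + apply (nodes_restr _ _ _ (IH e eg)); auto.
    + apply U; auto. left; auto.
    + rewrite (nodes_dom _ _ _ (IH e eg) _ h1). left; auto.
  (* A node of a limit level is determined by a level of [Cs g] and a node there from which it is
     the canonical extension. *)
  - apply (card_le_trans _ {d : seg g & {x | nodes (s (proj1_sig d)) x}}).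
    { apply (card_le_rel _ _ (fun y p =>
        proj1_sig y = ladder_union (Cs g) (proj1_sig (projT1 p)) (proj1_sig (projT2 p)))).
      - intros [y [d [x [Cd [hx E]]]]].
        exists (existT (fun d : seg g => {x | nodes (s (proj1_sig d)) x}) (exist _ d (Cg d Cd)) (exist _ x hx)).
        auto.
      - intros y y' p E E'. apply sig_eq. congruence. }
    eapply card_le_trans; [apply (card_le_sigma _ (stock g))|].
    { intros [d dg]. simpl. eapply card_le_trans; [apply (nodes_slim _ _ _ (IH d dg))|].
      apply stock_mono. left; auto. }
    eapply card_le_trans; [|apply stock_square]. apply card_le_prod; [apply seg_le_stock|apply card_le_refl].
  - intros b bg Sb. exfalso. destruct (proj2 L b bg) as [c [h1 h2]]. apply Sb in h2.
    apply (lt_irr b). eapply lt_le_tr; eauto.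
  - intros tg j j' E. destruct (Hd0 tg) as [C0 [t0 _]].
    assert (IH0 := IH d0 (Cg _ C0)).
    apply (path_inj _ _ _ IH0); auto.
    pose proof (Upre d0 (path (s d0) j) C0 (N0 tg j)) as h. unfold Fg in E. rewrite E in h.
    assert (dom (path (s d0) j) = dom (path (s d0) j')).
    { rewrite (nodes_dom _ _ _ IH0 _ (N0 tg j)), (nodes_dom _ _ _ IH0 _ (N0 tg j')); auto. }
    apply pre_eq; auto. eapply pre_common; [exact h|auto|right; auto].
  - intros _ d Cd td dmin j. assert (tg : theta < g) by (eapply lt_tr; [exact td|auto]).
    destruct (Hd0 tg) as [C0 [t0 min0]].
    assert (d = d0) by (apply le_antisym; auto). subst d. reflexivity.
  - intros _ y [d [x [Cd [hx ->]]]]. exists d. split; auto. intros e Ce de.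
    destruct (Udown d x e Cd hx Ce de) as [h1 ->]. symmetry. apply ladder_union_comp; auto.
Qed.
End Step.

Lemma stages_exist : exists s : K -> stage, forall g, ok s g.
Proof.
  destruct (least (fun _ => True)) as [o _].
  { apply NNPP. intros C. apply small_nat. exists (fun x => False_rect _ (C (ex_intro _ x I))).
    intros x. destruct (C (ex_intro _ x I)). }
  pose (x0 := mk o (fun c => c)).
  apply (wf_build K stage lt lt_wf (Stage (fun _ => True) (fun _ => x0) (fun _ _ x => x)) stage_ok).
  intros g s IH.
  destruct (classic (nonzero lt g)) as [nz|Z].
  2:{ apply stage_exists_zero; auto. intros b h. apply Z. exists b; auto. }
  destruct (classic (is_limit lt g)) as [L|N].
  { apply stage_exists_limit; auto. }
  assert (X : exists b, b < g /\ forall c, ~ (b < c /\ c < g)).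
  { apply NNPP. intros C. apply N. split; auto. intros b hb. apply NNPP. intros C'. apply C.
    exists b. split; auto. intros c hc. apply C'. eauto. }
  destruct X as [b [hb hm]]. apply (stage_exists_successor g s IH b).
  intros c. split.
  - intros h. apply not_lt. intros k. apply (hm c); auto.
  - intros h. eapply le_lt_tr; eauto.
Qed.

(** * The tree *)

Section Tree.
Variables (s : K -> stage) (chi : option K) (e : forall tau, (seg tau -> node) -> K).
Hypothesis s_ok : forall g, ok s g.
Hypothesis dia : diamond lt.
Hypothesis exp : exp_hyp lt chi.
Hypothesis e_inj : forall t v t' v', e t v = e t' v' ->
  existT (fun t => seg t -> node) t v = existT (fun t => seg t -> node) t' v'.
Hypothesis guess : forall t z (A : (seg t -> node) -> Prop) (h : K -> K) b,
  exists g, b <= g /\ (forall d, d < g -> h d < g) /\ Gz g t z /\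
    forall v, Ga g t v <-> (A v /\ e t v < g).
Hypothesis proxy : forall A : K -> K -> Prop, (forall i b, exists c, A i c /\ b <= c) ->
  stationary lt (fun a => E_ge_chi lt chi a /\ forall i, i < a ->
    sup_is lt (fun b => Cs a b /\
      (forall d, succ_omega lt (fun g => Cs a g /\ b <= g) d -> A i d)) a).

Definition tree (x : node) : Prop := nodes (s (dom x)) x.

Lemma tree_level g x : nodes (s g) x <-> tree x /\ dom x = g.
Proof.
  unfold tree. split.
  - intros h. pose proof (nodes_dom _ _ _ (s_ok g) x h) as E. rewrite E. auto.
  - intros [h <-]. auto.
Qed.

Lemma tree_restr x b : tree x -> b <= dom x -> nodes (s b) (restr x b).
Proof.
  intros hx [h| ->].
  - apply (nodes_restr _ _ _ (s_ok (dom x)) b h). auto.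
  - rewrite (pre_restr_eq x); auto. apply pre_refl.
Qed.

Lemma restr_restr x d b : d <= dom x -> b <= d -> restr (restr x d) b = restr x b.
Proof. intros h k. symmetry. apply restr_of_pre; auto. apply restr_pre; auto. Qed.

Lemma small_level g : small {x | nodes (s g) x}.
Proof. eapply small_mono; [apply (nodes_slim _ _ _ (s_ok g))|apply small_stock]. Qed.

Lemma small_tree_below b : small {x | tree x /\ dom x < b}.
Proof.
  apply (small_mono _ {d : seg b & {x | nodes (s (proj1_sig d)) x}}).
  - apply (card_le_rel _ _ (fun x (p : {d : seg b & {x | nodes (s (proj1_sig d)) x}}) =>
      proj1_sig x = proj1_sig (projT2 p))).
    + intros [x [h1 h2]].
      exists (existT (fun d : seg b => {x | nodes (s (proj1_sig d)) x}) (exist _ (dom x) h2)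
        (exist (nodes (s (dom x))) x h1)).
      auto.
    + intros x x' p E E'. apply sig_eq. congruence.
  - apply small_sigma; [apply small_seg|]. intros d. apply small_level.
Qed.

(** The tree below [b] has some size [lam] below [kappa], and there are at most [lam] to the power
    [tau] vectors, which [exp_hyp] bounds. *)
Lemma small_vectors tau b : below lt chi tau -> small (seg tau -> {x | tree x /\ dom x < b}).
Proof.
  intros ht. destruct (small_into_K {x | tree x /\ dom x < b}) as [lam [f Hf]].
  { eapply card_le_trans; [apply card_le_sig|apply node_into_K; auto]. }
  { apply small_tree_below. }
  destruct (exp lam) as [a Ha]. eapply small_mono; [|apply (small_seg a)].
  eapply card_le_trans; [|exact Ha].
  exists (fun v => existT (fun mu : {m | below lt chi m} => seg (proj1_sig mu) -> seg lam)
    (exist _ tau ht) (fun i => f (v i))).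
  intros v v' E. apply inj_pairT2 in E. apply functional_extensionality. intros i.
  apply Hf. exact (f_equal (fun u => u i) E).
Qed.

Lemma bound_vectors tau b (R : (seg tau -> node) -> K -> Prop) : below lt chi tau ->
  exists c, forall v, (forall i, tree (v i) /\ dom (v i) <= b) -> (exists x, R v x) ->
    exists x, R v x /\ x < c.
Proof.
  intros ht. destruct (no_max b) as [b' hb].
  destruct (small_rel_bounded _ (fun (v : seg tau -> {x | tree x /\ dom x < b'}) x =>
    R (fun i => proj1_sig (v i)) x) (small_vectors tau b' ht)) as [c Hc].
  exists c. intros v hv hR.
  assert (hv' : forall i, tree (v i) /\ dom (v i) < b').
  { intros i. destruct (hv i). split; auto. eapply le_lt_tr; eauto. }
  exact (Hc (fun i => exist _ (v i) (hv' i)) hR).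
Qed.

(* A member [y] of [A] of height at least [a] is, at level [a], the lift of its restriction
   [z] to some level [d] in [Cs a], because [cf a] exceeds its length. The guess of [z] at
   a successor point [g] of [Cs a] then put some member of [A] below [y]. *)
Lemma comparable_pair tau (A : (seg tau -> node) -> Prop) b0 : below lt chi tau -> nonzero lt tau ->
  (forall v, A v -> (forall i, tree (v i)) /\ exists d, forall i, dom (v i) = d) ->
  (forall v, A v -> forall d i j, b0 <= d -> d <= dom (v i) -> d <= dom (v j) ->
     restr (v i) d = restr (v j) d -> i = j) ->
  card_le K {v | A v} ->
  exists x y, A x /\ A y /\ card_le {i | ~ sub (x i) (y i)} (seg theta) /\
    forall i, (forall c, ~ c < proj1_sig i) -> sub (x i) (y i).
Proof.
  intros ht [o ho] HA Hinj HK.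
  (* [h1]-closed levels reflect the existence of a member of [A] above a given vector. *)
  assert (N1 : forall d, exists c, forall t : seg tau -> node, (forall i, tree (t i) /\ dom (t i) <= d) ->
    (exists v, A v /\ forall i, pre (t i) (v i)) ->
    exists v, A v /\ (forall i, pre (t i) (v i)) /\ e tau v < c /\ forall i, dom (v i) < c).
  { intros d. destruct (bound_vectors tau d (fun t x => exists v, A v /\ (forall i, pre (t i) (v i)) /\
      e tau v <= x /\ forall i, dom (v i) <= x) ht) as [c Hc].
    exists c. intros t h [v [h1 h2]].
    destruct (Hc t h) as [x [[v' [k1 [k2 [k3 k4]]]] k5]].
    - destruct (HA v h1) as [_ [dv hdv]]. destruct (max2 (e tau v) dv) as [x [l1 l2]].
      exists x, v. repeat split; auto; try apply h2. intros i. rewrite hdv. auto.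
    - exists v'. repeat split; auto; try apply k2. { eapply le_lt_tr; eauto. }
      intros i. eapply le_lt_tr; eauto. }
  destruct (choice _ N1) as [h1 H1].
  (* Closure under [h2] makes [a] a limit above [b0] and puts below [a] the code of every vector
     from a level below [a]. *)
  assert (N2 : forall d, exists c, d < c /\ b0 < c /\
    forall z : seg tau -> node, (forall i, tree (z i) /\ dom (z i) <= d) -> e tau z < c).
  { intros d. destruct (bound_vectors tau d (fun z x => x = e tau z) ht) as [c Hc].
    destruct (no_max d) as [c1 k1]. destruct (no_max b0) as [c2 k2].
    destruct (max2 c c1) as [c3 [l1 l2]]. destruct (max2 c3 c2) as [c4 [l3 l4]].
    exists c4. repeat split.
    - eapply lt_le_tr; [exact k1|]. eapply le_tr; eauto.
    - eapply lt_le_tr; eauto.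
    - intros z hz. destruct (Hc z hz) as [x [-> h]]; [eauto|].
      eapply lt_le_tr; [exact h|]. eapply le_tr; eauto. }
  destruct (choice _ N2) as [h2 H2].
  (* The [i]-th cofinal set consists of the [h1]-closed points that correctly guess the vector coded
     by [i] and the family [A]; if [i] is no code, it is everything. *)
  destruct (proxy (fun i b => forall z : seg tau -> node, e tau z = i ->
    Gz b tau z /\ (forall v, Ga b tau v <-> (A v /\ e tau v < b)) /\ forall d, d < b -> h1 d < b))
    with (C := fun b => nonzero lt b /\ forall d, d < b -> h2 d < b) as [a [[a_nz a_cl] [a_cof a_sup]]].
  { intros i b. destruct (classic (exists z, e tau z = i)) as [[z hz]|N].
    - destruct (guess tau z A h1 b) as [g [k1 [k2 [k3 k4]]]]. exists g. split; auto.
      intros z' hz'. rewrite <- hz in hz'. apply e_inj, inj_pairT2 in hz'. subst z'. auto.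
    - exists b. split; [|right; auto]. intros z hz. destruct N; eauto. }
  { apply club_closure_points. }
  assert (La : is_limit lt a).
  { split; auto. intros b hb. exists (h2 b). split; auto. apply H2. }
  destruct (Cs_club a La) as [C1 [C2 _]]. pose proof (ladder_Cs a La) as hC.
  (* Fewer than [kappa] vectors have all their heights below [a], so some member of [A] reaches
     level [a]. *)
  assert (Y : exists y dy, A y /\ a <= dy /\ forall i, dom (y i) = dy).
  { apply NNPP. intros C.
    assert (B : forall v, A v -> forall i, tree (v i) /\ dom (v i) < a).
    { intros v hv i. destruct (HA v hv) as [k [d hd]]. split; auto. rewrite hd.
      apply not_le. intros q. apply C. exists v, d. auto. }
    revert HK. eapply small_mono; [|apply (small_vectors tau a ht)].
    exists (fun v i => exist (fun x => tree x /\ dom x < a) (proj1_sig v i) (B _ (proj2_sig v) i)).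
    intros v v' E. apply sig_eq. apply functional_extensionality. intros i.
    exact (f_equal (fun u => proj1_sig (u i)) E). }
  destruct Y as [y [dy [Ay [ady hdy]]]]. destruct (HA y Ay) as [Ty _].
  assert (N3 : forall i, exists d0, d0 < a /\ forall d, Cs a d -> d0 <= d ->
    restr (y i) a = lift (s a) (Cs a) d (restr (restr (y i) a) d)).
  { intros i. apply (nodes_limit _ _ _ (s_ok a) La). apply tree_restr; auto. rewrite hdy; auto. }
  destruct (choice _ N3) as [dl Hdl].
  (* The levels [dl i] are indexed by [tau], below [chi], hence cannot be cofinal in [a]. *)
  assert (N4 : exists b, b < a /\ forall i, dl i < b).
  { apply NNPP. intros C. apply (a_cof (fun c => exists i, dl i = c)).
    - intros b [i <-]. apply Hdl.
    - intros b hb. apply NNPP. intros C'. apply C. exists b. split; auto. intros i.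
      apply not_le. intros k. apply C'. eauto.
    - exists tau. split; auto. apply (card_le_rel _ _ (fun c i => dl i = proj1_sig c)).
      + intros [c [i hi]]. eauto.
      + intros c c' i E E'. apply sig_eq. congruence. }
  destruct N4 as [b1 [b1a Hb1]].
  assert (N5 : exists d, Cs a d /\ b0 <= d /\ b1 <= d).
  { assert (b0a : b0 < a) by (destruct (H2 b1) as [_ [? _]]; eapply lt_tr; eauto).
    destruct (le_total b0 b1) as [k|k].
    - destruct (C2 b1 b1a) as [d [? ?]]. exists d. repeat split; auto. eapply le_tr; eauto.
    - destruct (C2 b0 b0a) as [d [? ?]]. exists d. repeat split; auto. eapply le_tr; eauto. }
  destruct N5 as [d [Cd [b0d b1d]]]. assert (da := C1 d Cd).
  pose (z := fun i => restr (y i) d).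
  assert (da' : d <= a) by (left; auto).
  assert (Tz : forall i, nodes (s d) (z i)).
  { intros i. apply tree_restr; auto. rewrite hdy. eapply le_tr; eauto. }
  (* From [d] on, the canonical extension of [z] along [Cs a] runs below [y]. *)
  assert (thread : forall c, Cs a c -> d <= c -> forall i, nodes (s c) (lift (s c) (Cs a) d (z i)) /\
    pre (lift (s c) (Cs a) d (z i)) (y i)).
  { intros c Cc dc i. assert (ca := C1 c Cc). split.
    { apply lift_nodes_le; auto. apply (ladder_mono a); auto. left; auto. }
    apply (pre_tr _ (restr (y i) a)). 2: { apply restr_pre. rewrite hdy; auto. }
    destruct (Hdl i) as [_ k]. rewrite (k d); auto.
    2: { left. eapply lt_le_tr; eauto. }
    rewrite restr_restr; auto. 2: rewrite hdy; auto.
    apply lift_comp_le; auto. { left; auto. } exact (Tz i). }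
  assert (ez : e tau z < a).
  { eapply lt_tr; [|apply (a_cl d da)]. apply H2. intros i. specialize (Tz i).
    apply tree_level in Tz as [k k']. split; auto. right; auto. }
  (* The code of [z] is one of the indices below [a]. The point [g] of [Cs a] next after the
     resulting [b] belongs to [succ_omega] of the part from [b] on, so the guess at [g] is right. *)
  destruct (proj2 (a_sup _ ez) d da) as [b [[Cb Hb] db]]. assert (ba := C1 b Cb).
  assert (N6 : exists c, Cs a c /\ b < c).
  { destruct (proj2 La b ba) as [c1 [k1 k2]]. destruct (C2 c1 k2) as [c [k3 k4]].
    exists c. split; auto. eapply lt_le_tr; eauto. }
  destruct (least _ N6) as [g [[Cg bg] gmin]]. assert (ga := C1 g Cg).
  assert (lastb : last_below (Cs a) g b).
  { repeat split; auto. intros c Cc hc. apply not_lt. intros k.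
    apply (lt_irr g). eapply le_lt_tr; [|exact hc]. apply gmin; auto. }
  destruct (Hb g) with (z := z) as [Gzg [Gag clg]]; auto.
  { split; [split; [auto|left; auto]|]. split.
    - exists b. split; auto. split; auto. right; auto.
    - apply finite_at_most_one.
      assert (X : forall c, (Cs a c /\ b <= c) /\ c < g -> c = b).
      { intros c [[k1 k2] k3]. apply le_antisym; auto. apply lastb; auto. }
      intros c c' k k'. rewrite (X c k), (X c' k'). auto. }
  assert (tinj : forall c, Cs a c -> d <= c -> forall i, lift (s c) (Cs a) d (z i) = restr (y i) c).
  { intros c Cc dc i. destruct (thread c Cc dc i) as [k1 k2]. symmetry. apply pre_restr_eq; auto.
    apply (nodes_dom _ _ _ (s_ok c)); auto. }
  assert (lay : forall c i, c < a -> c <= dom (y i)).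
  { intros c i hc. rewrite hdy. left. eapply lt_le_tr; eauto. }
  destruct (lift_seal _ _ _ (s_ok g) (Cs a) b bg (ladder_mono a g _ hC (or_introl ga)) lastb
    tau z d (lt_tr _ _ _ db bg) Gzg Cd (or_introl db) Tz) as [v [Gv Hv]].
  - intros i j E. apply (Hinj y Ay d); auto.
  (* The vector [y] itself lies above the lift of [z] to [b]. As [g] is [h1]-closed, a member of [A]
     above that lift already has its code and heights below [g]. *)
  - destruct (H1 b (fun i => lift (s b) (Cs a) d (z i))) as [v [k1 [k2 [k3 k4]]]].
    + intros i. destruct (thread b Cb (or_introl db) i) as [k _]. apply tree_level in k as [k k'].
      split; auto. right; auto.
    + exists y. split; auto. intros i. apply thread; auto. left; auto.
    + specialize (clg b bg). exists v. split.
      * apply Gag. split; auto. eapply lt_tr; eauto.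
      * intros i. split; [|apply k2]. assert (hv : dom (v i) < g) by (eapply lt_tr; eauto).
        exists hv. apply HA; auto.
  - assert (S : forall i, (forall c, ~ c < proj1_sig i) \/
        (forall j, path (s b) j <> lift (s b) (Cs a) d (z i)) -> sub (v i) (y i)).
    { intros i hi. specialize (Hv i hi). apply sub_pre in Hv as [k1 k2].
      destruct (thread g Cg) with (i := i) as [_ k3]. { left; eapply lt_tr; eauto. }
      apply sub_pre. split; [eapply pre_tr; eauto|]. eapply lt_le_tr; [exact k2|]. apply k3. }
    exists v, y. split; [apply Gag; auto|]. split; auto. split.
    (* Each exceptional index has its image on the path at level [b], and distinct indices have
       distinct images there. *)
    + apply (card_le_rel _ _ (fun i j => path (s b) j = lift (s b) (Cs a) d (z (proj1_sig i)))).
      * intros [i hi]. simpl. apply NNPP. intros C. apply hi. apply S. right. intros j E. eauto.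
      * intros i i' j E E'. apply sig_eq. apply (Hinj y Ay b); auto.
        { eapply le_tr; [exact b0d|]. left; auto. }
        rewrite <- !(tinj b Cb); auto; try (left; auto; fail). congruence.
    + intros i hi. apply S; auto.
Qed.

(** * Freeness, Souslinity and the ascent path *)

Variable eta : K.
Hypothesis theta_infinite : infinite_ord lt theta.
Hypothesis theta_eta : theta < eta.
Hypothesis eta_chi : below lt chi eta.

Lemma tree_downward_closed : downward_closed lt tree.
Proof.
  intros x y hy h. apply sub_pre in h as [h k]. rewrite (pre_restr x y h).
  exact (tree_restr y (dom x) hy (or_introl k)).
Qed.

Lemma tree_prolific : prolific lt tree.
Proof.
  intros x i hx hi. destruct (succ_exists (dom x)) as [g Hg].
  assert (xg : dom x < g) by (apply Hg; right; auto).
  destruct (nodes_prolific _ _ _ (s_ok g) (dom x) xg Hg x i hx hi) as [y [h1 [h2 h3]]].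
  apply tree_level in h1 as [h1 <-]. exists y. split; auto. split; [apply sub_pre; auto|].
  split; auto. intros h. rewrite <- val_in. auto.
Qed.

Lemma tree_slim : slim lt tree.
Proof.
  intros a. eapply card_le_trans; [|apply (nodes_slim _ _ _ (s_ok a))].
  apply card_le_subset. intros x. apply tree_level.
Qed.

Lemma tree_free : free lt chi eta tree.
Proof.
  intros tau ht nz beta w hw winj A HA HK.
  destruct (comparable_pair tau A beta ht nz) as [x [y [Ax [Ay [h _]]]]]; auto.
  - intros v hv. destruct (HA v hv) as [h1 [h2 _]]. auto.
  - intros v hv d i j bd di dj E. destruct (HA v hv) as [_ [_ hc]]. apply winj.
    (* The coordinates lie above the distinct nodes [w k], so their restrictions stay distinct from
       level [beta] on. *)
    assert (W : forall k, d <= dom (v k) -> w k = restr (restr (v k) d) beta).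
    { intros k dk. rewrite restr_restr; auto. destruct (hw k) as [_ hk]. rewrite <- hk.
      apply pre_restr, compat_pre; [apply compat_sym; auto|]. rewrite hk. eapply le_tr; eauto. }
    rewrite (W i), (W j), E; auto.
  - exists x, y. split; auto. split; auto. exists theta. auto.
Qed.

(** A node is a vector of length one. Its only index is the least one, where [comparable_pair] has
    no exceptions. *)
Lemma tree_no_antichain (A : node -> Prop) : (forall x, A x -> tree x) ->
  (forall x y, A x -> A y -> x <> y -> ~ compat lt x y) -> ~ card_le K {x | A x}.
Proof.
  intros HT HA HK.
  destruct (least (fun _ => True)) as [o [_ Ho]]; [exists theta; auto|].
  destruct (succ_exists o) as [one Hone].
  assert (oo : o < one) by (apply Hone; right; auto).
  assert (X : forall i : seg one, i = exist _ o oo).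
  { intros [i hi]. apply sig_eq. simpl. apply le_antisym; auto. apply Hone; auto. }
  destruct (comparable_pair one (fun v => A (v (exist _ o oo))) o) as [x [y [Ax [Ay [_ h]]]]].
  - assert (h : one < eta).
    { eapply le_lt_tr; [|exact theta_eta]. apply not_lt. intros h.
      apply nat_not_finite. eapply finite_mono; [exact theta_infinite|].
      apply finite_at_most_one. intros a b ha hb.
      apply Hone in h. assert (a < o) by (eapply lt_le_tr; eauto).
      destruct (lt_irr o). eapply le_lt_tr; [apply Ho|]; eauto. }
    destruct chi; simpl in *; auto. eapply lt_tr; eauto.
  - exists o. auto.
  - intros v hv. split; [|exists (dom (v (exist _ o oo)))]; intros i; rewrite (X i); auto.
  - intros v _ d i j _ _ _ _. rewrite (X i). auto.
  - destruct HK as [f Hf]. exists (fun k => exist (fun v : seg one -> node => A (v (exist _ o oo)))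
      (fun _ => proj1_sig (f k)) (proj2_sig (f k))).
    intros k k' E. apply Hf, sig_eq. inversion E as [E'].
    exact (f_equal (fun u => u (exist _ o oo)) E').
  - specialize (h (exist _ o oo)). simpl in h. assert (h' : sub (x (exist _ o oo)) (y (exist _ o oo))).
    { apply h. intros c hc. destruct (lt_irr o). eapply le_lt_tr; eauto. }
    apply (HA _ _ Ax Ay).
    + intros E. rewrite E in h'. apply sub_pre in h' as [_ h']. destruct (lt_irr _ h').
    + right; left; auto.
Qed.

(** The nodes that leave a cofinal branch in one step, one for each level of departure, would form
    an antichain of size [kappa]. *)
Lemma tree_no_branch (B : node -> Prop) : (forall x, B x -> tree x) ->
  (forall x y, B x -> B y -> compat lt x y) -> ~ (forall a, exists x, B x /\ dom x = a).
Proof.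
  intros HT HB Hd.
  destruct (least (fun _ => True)) as [o [_ Ho]]; [exists theta; auto|].
  destruct (succ_exists o) as [one Hone].
  assert (oo : o < one) by (apply Hone; right; auto).
  assert (Fo : finite_ord lt o).
  { apply finite_at_most_one. intros a b h. destruct (lt_irr o). eapply le_lt_tr; eauto. }
  assert (F1 : finite_ord lt one).
  { apply finite_at_most_one. intros a b ha hb. apply Hone in ha. apply Hone in hb.
    apply (eq_trans (y := o)); [|symmetry]; apply le_antisym; auto. }
  (* The node of [B] at level [a] has successors with last entries [o] and [one], and they cannot
     both lie on [B]. *)
  assert (N : forall a, exists y, tree y /\ ~ B y /\ (forall c, c < dom y <-> c <= a) /\
    exists x, B x /\ dom x = a /\ pre x y).
  { intros a. destruct (Hd a) as [x [Bx hx]].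
    destruct (tree_prolific x o (HT x Bx)) as [y [h1 [h2 [h3 h4]]]]; auto.
    destruct (tree_prolific x one (HT x Bx)) as [y' [h1' [h2' [h3' h4']]]]; auto.
    rewrite hx in *. apply sub_pre in h2 as [h2 h5]. apply sub_pre in h2' as [h2' h5'].
    destruct (classic (B y)) as [By|By]; [|exists y; repeat split; try apply h3; eauto].
    exists y'. repeat split; try apply h3'; eauto. intros By'.
    assert (dom y = dom y').
    { apply le_antisym; apply not_lt; intros k.
      - apply h3 in k. apply h3' in k. destruct (lt_irr _ k).
      - apply h3' in k. apply h3 in k. destruct (lt_irr _ k). }
    assert (y = y').
    { apply pre_eq; auto. apply compat_pre; auto. right; auto. }
    subst y'. apply (lt_irr one). rewrite hx in h5. rewrite <- (h4' h5) at 1. rewrite (h4 h5). auto. }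
  destruct (choice _ N) as [Y HY].
  assert (inc : forall a b, a < b -> ~ compat lt (Y a) (Y b)).
  { intros a b ab C. destruct (HY a) as [Ta [nBa [da _]]]. destruct (HY b) as [_ [_ [db [x [Bx [dx px]]]]]].
    assert (ha : dom (Y a) <= b). { apply not_lt. intros k. apply da in k.
      apply (lt_irr a). eapply lt_le_tr; eauto. }
    assert (hb : b < dom (Y b)) by (apply db; right; auto).
    assert (p : pre (Y a) x).
    { apply (pre_common _ _ (Y b)); auto; [|rewrite dx; auto]. apply compat_pre; auto.
      left. eapply le_lt_tr; eauto. }
    destruct (Hd (dom (Y a))) as [w [Bw hw]]. apply nBa.
    replace (Y a) with w; auto. apply pre_eq; auto. apply (pre_common _ _ x); auto.
    - apply compat_pre; auto. rewrite hw. apply p.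
    - right; auto. }
  assert (inj : forall a b, compat lt (Y a) (Y b) -> a = b).
  { intros a b C. destruct (lt_tot a b) as [h|[h|h]]; auto; exfalso; [eapply inc; eauto|].
    apply compat_sym in C. eapply inc; eauto. }
  apply (tree_no_antichain (fun y => exists a, y = Y a)).
  - intros x [a ->]. apply HY.
  - intros x y [a ->] [b ->] ne C. apply ne. f_equal. auto.
  - exists (fun a => exist _ (Y a) (ex_intro _ a eq_refl)). intros a b E. inversion E as [E'].
    apply inj. left; auto.
Qed.

Lemma tree_souslin : souslin lt tree.
Proof.
  split; [|split; [|split]].
  - intros a. destruct (nodes_nonempty _ _ _ (s_ok a)) as [x hx]. apply tree_level in hx. eauto.
  - intros a. apply small_into_K.
    + eapply card_le_trans; [apply card_le_sig|apply node_into_K; auto].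
    + eapply small_mono; [apply tree_slim|apply (small_stock a)].
  - intros [B [h1 [h2 h3]]]. apply (tree_no_branch B); auto.
  - intros [A [h1 [h2 h3]]]. apply (tree_no_antichain A); auto.
Qed.

(** At levels up to [theta], where the recursion says nothing about the path, the restrictions of
    its values at [t1] are used. These form exact chains, and injectivity is witnessed at [t1]. *)
Lemma tree_ascent_path : exists f : K -> seg theta -> node,
  ascent_path lt theta tree f /\ injective_path lt theta f.
Proof.
  destruct (succ_exists theta) as [t1 Ht1]. assert (tt1 : theta < t1) by (apply Ht1; right; auto).
  exists (fun a j => if dec (theta < a) then path (s a) j else restr (path (s t1) j) a).
  assert (N : forall a, theta < a -> forall j, tree (path (s a) j) /\ dom (path (s a) j) = a).
  { intros a h j. apply tree_level. apply (path_nodes _ _ _ (s_ok a)); auto. }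
  split; [split|].
  - intros a j. destruct (dec (theta < a)) as [h|h]; [auto|].
    apply tree_level. apply tree_restr; [apply N; auto|]. destruct (N t1 tt1 j) as [_ ->].
    left. apply Ht1. apply not_lt. auto.
  - intros a b ab. destruct (dec (theta < a)) as [ha|ha]; destruct (dec (theta < b)) as [hb|hb].
    + eapply finite_subset; [|apply (path_ascent _ _ _ (s_ok b) a ab ha)].
      intros j. cbv beta. intros h k. apply h. apply sub_pre. split; auto.
      destruct (N a ha j) as [_ ->]. destruct (N b hb j) as [_ ->]. auto.
    + destruct hb. eapply lt_tr; eauto.
    + assert (at1 : a < t1) by (apply Ht1, not_lt; auto).
      assert (Q : forall j, pre (path (s t1) j) (path (s b) j) -> sub (restr (path (s t1) j) a) (path (s b) j)).
      { intros j p. apply sub_pre. split; [|destruct (N b hb j) as [_ ->]; exact ab].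
        eapply pre_tr; [|exact p]. apply restr_pre. destruct (N t1 tt1 j) as [_ ->]. left; auto. }
      assert (t1b : t1 <= b). { apply not_lt. intros k. apply Ht1 in k. apply (lt_irr b). eapply le_lt_tr; eauto. }
      destruct t1b as [k| <-].
      * eapply finite_subset; [|apply (path_ascent _ _ _ (s_ok b) t1 k tt1)].
        intros j. cbv beta. intros h p. apply h, Q, p.
      * apply finite_at_most_one. intros j j' h. destruct h. apply Q, pre_refl.
    + apply finite_at_most_one. intros j j' h. destruct h. apply sub_pre. split; [|exact ab].
      assert (E : b <= dom (path (s t1) j)).
      { destruct (N t1 tt1 j) as [_ ->]. left. apply Ht1, not_lt; auto. }
      apply (pre_common _ _ (path (s t1) j)).
      * apply restr_pre. left. eapply lt_le_tr; eauto.
      * apply restr_pre; auto.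
      * left; exact ab.
  - exists t1, (fun _ => True). split.
    + apply finite_at_most_one. tauto.
    + intros i j _ _. destruct (dec (theta < t1)) as [h|h]; [|tauto].
      apply (path_inj _ _ _ (s_ok t1)); auto.
Qed.
End Tree.
End Construction.
End Reg.
End Ord.

Theorem theorem6p1 (K : Type) (lt : K -> K -> Prop) (chi : option K) (theta eta : K) :
  well_order lt ->
  regular_uncountable lt ->
  chi_cardinal lt chi ->
  P14 lt (E_ge_chi lt chi) ->
  exp_hyp lt chi ->
  is_card lt theta -> infinite_ord lt theta ->
  is_succ_card lt theta eta -> below lt chi eta ->
  exists T : node lt -> Prop,
    downward_closed lt T /\ prolific lt T /\ slim lt T /\
    free lt chi eta T /\ souslin lt T /\
    exists f : K -> seg lt theta -> node lt,
      ascent_path lt theta T f /\ injective_path lt theta f.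
Proof.
  intros wo reg _ [dia [Cs [C1 [C2 C3]]]] exp _ inf [te _] chi_eta.
  destruct (diamond_guess K lt wo reg dia) as [e [Gz [Ga [e1 [e2 e3]]]]].
  destruct (stages_exist K lt wo reg theta Cs Gz Ga C1 C2 e2) as [s Hs].
  exists (tree K lt theta s). split; [|split; [|split; [|split; [|split]]]].
  - eapply tree_downward_closed; eauto.
  - eapply tree_prolific; eauto.
  - eapply tree_slim; eauto.
  - eapply tree_free; eauto.
  - eapply tree_souslin; eauto.
  - eapply tree_ascent_path; eauto.
Qed.
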